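(* Let $G$ be a finite group and $p$ a prime. (a) Let $u \in \mathrm{V}(\mathbb{Z}G)$ be a unit of order $p$. Then there exists a finite group $H$ containing $G$ such that $u$ is conjugate to some $g \in G$ within $\mathbb{Q}H$. (b) Let $U$ be a subgroup of $\mathrm{V}(\mathbb{Z}G)$ isomorphic to $C_p \times C_p$. Then there exists a finite group $H$ containing $G$ such that $U$ is conjugate to a subgroup of $G$ within $\mathbb{Q}H$.
   Context: $\mathbb{Z}G$ denotes the integral group ring of $G$ and $\mathrm{V}(\mathbb{Z}G)$ the group of units of $\mathbb{Z}G$ of augmentation $1$; $G$ is regarded as a subgroup of $\mathrm{V}(\mathbb{Z}G)$. $C_p$ denotes the cyclic group of order $p$. If $G$ is a subgroup of $H$, then $\mathbb{Z}G$ is regarded as a subring of $\mathbb{Z}H \subseteq \mathbb{Q}H$. Two elements (or subgroups) are conjugate within $\mathbb{Q}H$ if they are conjugate by a unit of the rational group algebra $\mathbb{Q}H$. *)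

(* Defs.v *)
From HB Require Import structures.
From mathcomp Require Import all_boot all_order all_algebra all_fingroup.
From mathcomp Require Import boolp.

Set Implicit Arguments.
Unset Strict Implicit.
Unset Printing Implicit Defensive.

Import GRing.Theory.
Local Open Scope ring_scope.

(* The group ring R[gT]: x g is the coefficient of g in x.  The name is an    *)
(* alias, so that the convolution product below is not confused with the      *)
(* pointwise structure of {ffun gT -> R}.                                     *)
Definition grpRing (R : nzRingType) (gT : finGroupType) := {ffun gT -> R}.

Section GroupRing.
Variables (R : nzRingType) (gT : finGroupType).
Implicit Types (x y z : grpRing R gT) (g h k : gT).

HB.instance Definition _ := GRing.Zmodule.copy (grpRing R gT) {ffun gT -> R}.

Definition grpRing_of g : grpRing R gT := [ffun h => (h == g)%:R].

Definition grpRing_mul x y : grpRing R gT :=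
  [ffun g => \sum_h x h * y (h^-1 * g)%g].

Fact grpRing_mulA : associative grpRing_mul.
Proof.
move=> x y z; apply/ffunP=> g; rewrite !ffunE.
under eq_bigr => h _ do rewrite ffunE mulr_sumr.
under [RHS]eq_bigr => h _ do rewrite ffunE mulr_suml.
rewrite [RHS]exchange_big; apply: eq_bigr => k _ /=.
rewrite [RHS](reindex (fun h => k * h)%g) /=; last first.
  by exists (fun h => k^-1 * h)%g => h _; rewrite ?mulKg ?mulKVg.
by apply: eq_bigr => h _; rewrite mulKg invMg !mulgA mulrA.
Qed.

Fact grpRing_mul1 : left_id (grpRing_of 1%g) grpRing_mul.
Proof.
move=> x; apply/ffunP=> g; rewrite ffunE (bigD1 1%g) //= big1 => [|h /negPf h1].
  by rewrite ffunE eqxx mul1r invg1 mul1g addr0.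
by rewrite ffunE h1 mul0r.
Qed.

Fact grpRing_mulr1 : right_id (grpRing_of 1%g) grpRing_mul.
Proof.
move=> x; apply/ffunP=> g; rewrite ffunE (bigD1 g) //= big1 => [|h /negPf hg].
  by rewrite ffunE mulVg eqxx mulr1 addr0.
by rewrite ffunE -eq_mulVg1 hg mulr0.
Qed.

Fact grpRing_mulDl : left_distributive grpRing_mul +%R.
Proof.
move=> x y z; apply/ffunP=> g; rewrite !ffunE -big_split.
by apply: eq_bigr => h _; rewrite ffunE mulrDl.
Qed.

Fact grpRing_mulDr : right_distributive grpRing_mul +%R.
Proof.
move=> x y z; apply/ffunP=> g; rewrite !ffunE -big_split.
by apply: eq_bigr => h _; rewrite ffunE mulrDr.
Qed.

Fact grpRing_1neq0 : grpRing_of 1%g != 0.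
Proof.
by apply/eqP=> /ffunP/(_ 1%g)/eqP; rewrite !ffunE eqxx oner_eq0.
Qed.

HB.instance Definition _ := GRing.Zmodule_isNzRing.Build (grpRing R gT)
  grpRing_mulA grpRing_mul1 grpRing_mulr1 grpRing_mulDl grpRing_mulDr
  grpRing_1neq0.

Definition grpRing_unit : pred (grpRing R gT) :=
  fun x => `[< exists y : grpRing R gT, y * x = 1 /\ x * y = 1 >].

Definition grpRing_inv x : grpRing R gT :=
  if pselect (exists y, y * x = 1 /\ x * y = 1) is left ex_y
  then projT1 (cid ex_y) else x.

Fact grpRing_mulVr : {in grpRing_unit, left_inverse 1 grpRing_inv *%R}.
Proof.
move=> x /asboolP x_unit; rewrite /grpRing_inv.
by case: pselect => // ex_y; case: cid => y [].
Qed.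

Fact grpRing_mulrV : {in grpRing_unit, right_inverse 1 grpRing_inv *%R}.
Proof.
move=> x /asboolP x_unit; rewrite /grpRing_inv.
by case: pselect => // ex_y; case: cid => y [].
Qed.

Fact grpRing_unitP x y : y * x = 1 /\ x * y = 1 -> grpRing_unit x.
Proof. by move=> xy1; apply/asboolP; exists y. Qed.

Fact grpRing_inv_out : {in [predC grpRing_unit], grpRing_inv =1 id}.
Proof.
move=> x /asboolPn nx_unit; rewrite /grpRing_inv.
by case: pselect.
Qed.

HB.instance Definition _ := GRing.NzRing_hasMulInverse.Build (grpRing R gT)
  grpRing_mulVr grpRing_mulrV grpRing_unitP grpRing_inv_out.

Definition augmentation x : R := \sum_g x g.

Definition normalized_unit : pred (grpRing R gT) :=
  [pred u | (u \is a GRing.unit) && (augmentation u == 1)].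

Lemma grpRing_mulE x y g : (x * y) g = \sum_h x h * y (h^-1 * g)%g.
Proof. by rewrite [x * y]/(grpRing_mul x y) ffunE. Qed.

Lemma grpRing_ofM g h : grpRing_of (g * h)%g = grpRing_of g * grpRing_of h.
Proof.
apply/ffunP=> k; rewrite grpRing_mulE (bigD1 g) //= big1 => [|l /negPf lg].
  by rewrite !ffunE eqxx mul1r addr0 -(inj_eq (mulgI g^-1%g)) mulKg.
by rewrite ffunE lg mul0r.
Qed.

End GroupRing.

Arguments normalized_unit R gT : clear implicits.

(* The ring homomorphism Z[gT] -> Q[hT] extending a group homomorphism f; it  *)
(* is the inclusion ZG <= ZH <= QH when f embeds G in H.                      *)
Definition grpRing_intQ (gT hT : finGroupType) (f : gT -> hT)
    (x : grpRing int gT) : grpRing rat hT :=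
  [ffun h => \sum_(g | f g == h) (x g)%:~R].

Lemma grpRing_intQ_of (gT hT : finGroupType) (f : gT -> hT) (g : gT) :
  grpRing_intQ f (grpRing_of int g) = grpRing_of rat (f g).
Proof.
apply/ffunP=> h; rewrite !ffunE; case: eqVneq => [->|hfg].
  rewrite (bigD1 g) //= ffunE eqxx big1 ?addr0 // => k /andP[_ /negPf kg].
  by rewrite ffunE kg.
apply: big1 => k /eqP fk; rewrite ffunE; case: eqVneq => // kg.
by rewrite -fk kg eqxx in hfg.
Qed.

Lemma grpRing_intQM (gT hT : finGroupType) (f : {morphism [set: gT] >-> hT}) :
  {morph grpRing_intQ f : x y / x * y}.
Proof.
move=> x y; apply/ffunP=> h; rewrite grpRing_mulE ffunE.
under eq_bigr => g _ do rewrite grpRing_mulE rmorph_sum /=.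
under [RHS]eq_bigr => k _ do rewrite ffunE mulr_suml.
rewrite [RHS](exchange_big_dep xpredT) //= exchange_big /=.
apply: eq_bigr => a _; rewrite (big_pred1 (f a)) => [|k]; last by rewrite /= eq_sym.
rewrite ffunE mulr_sumr (reindex (fun b => a * b)%g) /=; last first.
  by exists (fun b => a^-1 * b)%g => b _; rewrite ?mulKg ?mulKVg.
apply: eq_big => [b|b _]; last by rewrite mulKg intrM.
by rewrite morphM ?inE // -(inj_eq (mulgI (f a)^-1%g)) mulKg.
Qed.

(* Multiplicative order exactly n. *)
Definition has_order (S : nzRingType) (u : S) (n : nat) : Prop :=
  [/\ (0 < n)%N, u ^+ n = 1 & forall m, (0 < m < n)%N -> u ^+ m <> 1].

Definition conjugate_elts (S : unitRingType) (a b : S) : Prop :=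
  exists2 x, x \is a GRing.unit & b = x^-1 * a * x.

Definition conjugate_sets (S : unitRingType) (A B : S -> Prop) : Prop :=
  exists2 x, x \is a GRing.unit &
    forall b, B b <-> exists2 a, A a & b = x^-1 * a * x.

(* The subset U of S is a group for the product of S, isomorphic to A.        *)
Definition isomorphic_to (S : nzRingType) (U : {pred S})
    (aT : finGroupType) (A : {group aT}) : Prop :=
  exists phi : aT -> S,
    [/\ {in A &, forall a b, phi (a * b)%g = phi a * phi b},
        {in A &, injective phi}
      & forall u, u \in U <-> exists2 a, a \in A & u = phi a].

(* Main.v *)
(**
Write e_C(u) for the sum of the coefficients of u over a conjugacy class C.  If
u has order p and augmentation 1, then e_C(u) = 0 unless C consists of elements
of order p.
- Rotating words gives, for q prime and a class function f, the congruence
  f(u^(q^N)) = (f o q-th power)(u^(q^(N-1))) modulo q^N.  For q <> p the powers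
  of u on both sides are periodic in N, so f(u^q) = (f o q-th power)(u) exactly;
  hence only p-elements matter, and u may be replaced by u^j, j prime to p,
  provided that C is replaced by C^j.
- If g has order p^k, k >= 2, then T : x |-> g^-1 x u on ZG has order p^k and
  T^(p^(k-1)) permutes a basis freely.  The ranks of the powers of T - 1 modulo
  p show that T has the character of a free module, so T has trace 0.
- C = 1 is the Berman-Higman theorem.

In H = Sym(G), with G embedded regularly, all elements of G of order p are
conjugate.  So any two embeddings of C_p, or of C_p x C_p, in the normalized
units of ZG agree on the characters of H, hence are conjugate over algC, and
therefore over Q.

For (b) it remains to see that G has a subgroup C_p x C_p as soon as V(ZG) has
one, U.  Otherwise a Sylow subgroup P of G has a unique subgroup Z of order p,
so P is cyclic or, for p = 2, generalized quaternion.  Let e in QG be the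
idempotent (1/p^2) sum U, and X a cyclic subgroup of P, of index 1 in the first
case and 2 in the second.  A faithful linear character of X occurs in the
G-module QG e with multiplicity (|G| - (p+1) |N(Z)|) / (|X| p^2).  As
|G : N(Z)| = 1 modulo |P|, this is not an integer when P = X, and it is an odd
integer when P is quaternion, whereas it has to be even because the module is
defined over the reals.
*)

Require Import Defs.
From mathcomp Require Import all_boot all_order all_algebra all_fingroup.
From mathcomp Require Import center nilpotent pgroup cyclic sylow abelian.
From mathcomp Require Import extremal fieldext algC cyclotomic algnum.
From mathcomp Require Import mxrepresentation classfun character.
From mathcomp Require Import zify.

Set Implicit Arguments.
Unset Strict Implicit.
Unset Printing Implicit Defensive.

Import Order.TTheory GRing.Theory Num.Theory.
Local Open Scope ring_scope.

(** * Powers in the integral group ring *)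

Section PermutationSums.

(** A point moved by s^(q^N) lies on an orbit of full length q^(N+1): a shorter orbit would have
    length dividing q^N. As [F] is constant on orbits, each orbit contributes a multiple of
    q^(N+1). *)
Lemma dvdz_sum_unfixed (W : finType) (s : {perm W}) q N (F : W -> int) :
  prime q -> (s ^+ (q ^ N.+1) = 1)%g -> (forall w, F (s w) = F w) ->
  ((q ^ N.+1)%:Z %| \sum_(w | iter (q ^ N) s w != w) F w)%Z.
Proof.
move=> q_pr sq1 Fs.
have Fiter i w : F (iter i s w) = F w by elim: i => //= i IHi; rewrite Fs.
rewrite (partition_big (porbit s) predT) //=.
apply: rpred_sum => O _.
have [w0 /andP[w0s /eqP defO] | noO] :=
  pickP [pred w | (iter (q ^ N) s w != w) && (porbit s w == O)]; last first.
  by rewrite big_pred0 ?dvdz0.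
have cardO : #|porbit s w0| = (q ^ N.+1)%N.
  have: (#|porbit s w0| %| q ^ N.+1)%N.
    rewrite porbitE card_orbit.
    apply: dvdn_trans (dvdn_indexg _ _) _.
    by rewrite [#|_|]/(#[s])%g order_dvdn sq1.
  case/dvdn_pfactor => // m le_m defm.
  move: le_m; rewrite leq_eqVlt => /predU1P[<- // | lt_m]; case/eqP: w0s.
  have /dvdnP[k ->]: (#|porbit s w0| %| q ^ N)%N by rewrite defm dvdn_exp2l.
  by elim: k => // k IHk; rewrite mulSn iterD IHk iter_porbit.
rewrite (eq_bigl [in porbit s w0]) => [|w /=]; last first.
  rewrite -defO eq_porbit_mem; apply/andP/idP => [[_ ] // | ].
  move=> w0w; split=> //; move: w0w; rewrite porbit_sym porbit_traject.
  case/trajectP => i _ defw0; apply: contra w0s => /eqP fix_w; apply/eqP.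
  by rewrite defw0 -iterD addnC iterD fix_w.
  rewrite (eq_bigr (fun=> F w0)) => [|w]; last first.
  by rewrite porbit_traject => /trajectP[i _ ->]; rewrite Fiter.
by rewrite sumr_const cardO -mulr_natr natz; apply: dvdz_mull; exact: dvdzz.
Qed.

End PermutationSums.

(** * Words invariant under a rotation *)

Section RotatedWords.

Lemma flatten_nseq_commute (I : Type) (k m : nat) (a b : seq I) :
  size a = m -> size b = (k * m)%N -> b ++ a = a ++ b ->
  b = flatten (nseq k a).
Proof.
move=> sza; elim: k b => [|k IHk] b szb ba; first by rewrite [b]size0nil.
have defb: b = a ++ drop m b.
  rewrite -{1}[b](cat_take_drop m); congr (_ ++ _).
  have := congr1 (take m) ba; rewrite takel_cat ?szb ?mulSn ?leq_addr //.
  by rewrite take_size_cat.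
move: szb ba; rewrite defb size_cat sza mulSn => /addnI szb' ba.
congr (_ ++ _); apply: IHk => //.
by move/(congr1 (drop m)): ba; rewrite -catA !drop_size_cat.
Qed.

(** Split w as a ++ b with a of length m; invariance means b ++ a = a ++ b, and a word commuting
    with a, of length a multiple of m, is a power of a. *)
Lemma rot_fixed_flatten (I : Type) (k m : nat) (w : seq I) :
  size w = (k.+1 * m)%N -> rot m w = w ->
  w = flatten (nseq k.+1 (take m w)).
Proof.
move=> szw rotw; rewrite -{1}[w](cat_take_drop m) /=; congr (_ ++ _).
apply: (@flatten_nseq_commute _ k m).
- by rewrite size_takel // szw mulSn leq_addr.
- by rewrite size_drop szw mulSn addKn.
by rewrite cat_take_drop.
Qed.

End RotatedWords.

(** * Class functions extended linearly to ZG, and powers modulo a prime power *)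

Section Pairing.
Variable gT : finGroupType.
Implicit Types (u v : grpRing int gT) (f : gT -> int).

Definition is_class_fun (T : Type) (f : gT -> T) :=
  forall x y, f (x * y)%g = f (y * x)%g.

(** The linear extension of [f] to ZG; at the indicator of a class C it gives the partial
    augmentation e_C. *)
Definition pairing f u : int := \sum_x u x * f x.

Lemma pairing_sum f (I : Type) (r : seq I) (P : pred I) (F : I -> grpRing int gT) :
  pairing f (\sum_(i <- r | P i) F i) = \sum_(i <- r | P i) pairing f (F i).
Proof.
rewrite /pairing exchange_big; apply: eq_bigr => x _.
by rewrite sum_ffunE mulr_suml.
Qed.

Lemma pairing_of f g : pairing f (grpRing_of int g) = f g.
Proof.
rewrite /pairing (bigD1 g) //= big1 => [|x /negPf xg].
  by rewrite ffunE eqxx mul1r addr0.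
by rewrite ffunE xg mul0r.
Qed.

Lemma expr_sum_of (I : finType) (g : I -> gT) n :
  (\sum_i grpRing_of int (g i)) ^+ n
  = \sum_(w : n.-tuple I) grpRing_of int (\prod_(i <- w) g i)%g.
Proof.
elim: n => [|n IHn].
  rewrite (big_pred1 [tuple]) => [|w]; rewrite ?big_nil //.
  by apply/esym/eqP/tuple0.
rewrite exprS IHn mulr_suml.
under eq_bigr => i _ do rewrite mulr_sumr.
rewrite pair_big /= (reindex (fun w : n.+1.-tuple I => (thead w, behead_tuple w))) /=.
  apply: eq_bigr => w _; rewrite -grpRing_ofM; congr (grpRing_of _ _).
  by rewrite [w in RHS]tuple_eta big_cons.
exists (fun iw => cons_tuple iw.1 iw.2) => [w _ | [i w] _] /=.
  by rewrite [RHS]tuple_eta; apply/val_inj.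
by rewrite theadE; congr (_, _); apply/val_inj.
Qed.

Lemma class_fun_prod_rot (T I : Type) (f : gT -> T) (g : I -> gT) m (w : seq I) :
  is_class_fun f ->
  f (\prod_(i <- rot m w) g i)%g = f (\prod_(i <- w) g i)%g.
Proof. by move=> fC; rewrite /rot big_cat fC -big_cat cat_take_drop. Qed.

Lemma prod_flatten_nseq (I : Type) (g : I -> gT) k (w : seq I) :
  (\prod_(i <- flatten (nseq k w)) g i = (\prod_(i <- w) g i) ^+ k)%g.
Proof.
elim: k => [|k IHk] /=; first by rewrite big_nil expg0.
by rewrite big_cat IHk expgS.
Qed.

(** Expand both powers as sums over words. Words moved by the rotation through q^N contribute a
    multiple of q^(N+1) by [dvdz_sum_unfixed]; the fixed ones are q-fold repetitions of words of
    length q^N and give exactly the second pairing. *)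
Lemma pairing_expX_sum_of f (I : finType) (g : I -> gT) q N :
  is_class_fun f -> prime q ->
  let u := \sum_i grpRing_of int (g i) in
  ((q ^ N.+1)%:Z %| pairing f (u ^+ (q ^ N.+1))
                      - pairing (fun x => f (x ^+ q)%g) (u ^+ (q ^ N)))%Z.
Proof.
move=> fC q_pr /=; rewrite !expr_sum_of !pairing_sum.
under eq_bigr => w _ do rewrite pairing_of.
under [X in _ - X]eq_bigr => w _ do rewrite pairing_of.
have rotI n : injective (fun w : n.-tuple I => rot_tuple 1 w).
  by move=> w1 w2 /(congr1 val)/rot_inj/val_inj.
pose s n : {perm n.-tuple I} := perm (@rotI n).
have iter_s n m (w : n.-tuple I) : (m <= n)%N -> iter m (s n) w = rot m w :> seq I.
  elim: m => [|m IHm] le_mn; first by rewrite rot0.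
  by rewrite rotS ?size_tuple //= permE /= IHm // ltnW.
rewrite (bigID (fun w => iter (q ^ N) (s _) w != w)) /= -addrA.
apply: rpredD.
  apply: dvdz_sum_unfixed => // [|w].
    apply/permP=> w; rewrite perm1 permX; apply/val_inj.
    by rewrite /= iter_s // rot_oversize ?size_tuple.
  by rewrite permE /= class_fun_prod_rot.
suff ->: \sum_(w : (q ^ N.+1).-tuple I | ~~ (iter (q ^ N) (s _) w != w))
            f (\prod_(i <- w) g i)%g
       = \sum_(w : (q ^ N).-tuple I) f ((\prod_(i <- w) g i) ^+ q)%g.
  by rewrite subrr rpred0.
have q_gt0 := prime_gt0 q_pr.
have nseqE A (x : A) : nseq q x = x :: nseq q.-1 x by case: (q) q_gt0.
have szh (v : (q ^ N).-tuple I) : size (flatten (nseq q (tval v))) == (q ^ N.+1)%N.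
  rewrite size_flatten /shape map_nseq sumn_nseq size_tuple.
  by rewrite mulnC expnS.
have szh' (w : (q ^ N.+1).-tuple I) : size (take (q ^ N) w) == (q ^ N)%N.
  by rewrite size_takel // size_tuple expnS leq_pmull.
rewrite (reindex_onto (fun v : (q ^ N).-tuple I => Tuple (szh v))
  (fun w : (q ^ N.+1).-tuple I => Tuple (szh' w))) /=.
  apply: eq_big => [v | v _]; last by rewrite prod_flatten_nseq.
  apply/andP; split; last first.
    apply/eqP/val_inj; rewrite /= nseqE /=.
    by rewrite take_size_cat ?size_tuple.
  apply/negPn/eqP/val_inj; rewrite /= iter_s ?expnS ?leq_pmull //=.
  rewrite nseqE /= -{1}(size_tuple v) rot_size_cat.
  elim: q.-1 => [|k IHk] /=; first by rewrite cats0.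
  by rewrite -catA IHk.
move=> w; rewrite negbK => /eqP/(congr1 val)/=.
rewrite iter_s ?expnS ?leq_pmull // => rotw; apply/val_inj => /=.
rewrite -[q in nseq q](prednK q_gt0); apply/esym/rot_fixed_flatten => //.
by rewrite size_tuple expnS prednK.
Qed.

Lemma exprD_mulz (R : nzRingType) (x y : R) (k : int) n :
  exists z, (x + y *~ k) ^+ n = x ^+ n + z *~ k.
Proof.
elim: n => [|n [z IHn]]; first by exists 0; rewrite mul0rz addr0 !expr0.
exists (x * z + (y * x ^+ n + (y * z) *~ k)).
by rewrite exprS IHn mulrDl !mulrDr -exprS !mulrzAl !mulrzAr !mulrzDl -!addrA.
Qed.

Lemma pairingD f u v : pairing f (u + v) = pairing f u + pairing f v.
Proof.
by rewrite -big_split; apply: eq_bigr => x _; rewrite ffunE mulrDl.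
Qed.

Lemma pairingMz f u k : pairing f (u *~ k) = pairing f u * k.
Proof.
have pairingMn n v : pairing f (v *+ n) = pairing f v *+ n.
  elim: n => [|n IHn]; last by rewrite !mulrS pairingD IHn.
  by rewrite !mulr0n /pairing big1 // => x _; rewrite ffunE mul0r.
have pairingN v : pairing f (- v) = - pairing f v.
  by rewrite -sumrN; apply: eq_bigr => x _; rewrite ffunE mulNr.
by rewrite -mulrzz; case: k => n; rewrite ?NegzE ?mulrNz ?pairingN -!pmulrn pairingMn.
Qed.

(* Modulo q ^ N.+1 all coefficients of u may be assumed to be nonnegative, so *)
(* that the n-th power of u becomes a sum over words of length n, on which    *)
(* rotations act. *)
Lemma pairing_expX f u q N : is_class_fun f -> prime q ->
  ((q ^ N.+1)%:Z %| pairing f (u ^+ (q ^ N.+1))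
                      - pairing (fun x => f (x ^+ q)%g) (u ^+ (q ^ N)))%Z.
Proof.
move=> fC q_pr; set Q := (q ^ N.+1)%N.
pose c x := `|(u x %% Q)%Z|%N.
pose v : grpRing int gT := [ffun x => - (u x %/ Q)%Z].
have Q_neq0 : Q%:Z != 0 by rewrite eqz_nat -lt0n expn_gt0 prime_gt0.
have defu : u + v *~ Q = \sum_(i : {x : gT & 'I_(c x)}) grpRing_of int (tag i).
  transitivity (\sum_x \sum_(j < c x) grpRing_of int x); last first.
    by rewrite sig_big_dep.
  apply/ffunP=> x; rewrite !ffunE sum_ffunE (bigD1 x) //=.
  rewrite sum_ffunE [X in _ = _ + X]big1 => [|y /negPf yx]; last first.
    by rewrite sum_ffunE big1 // => j _; rewrite ffunE eq_sym yx.
  under eq_bigr => j _ do rewrite ffunE eqxx.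
  rewrite addr0 sumr_const card_ord ffunMzE ffunE mulrzz mulNr.
  rewrite /c -mulr_natr mul1r natz gez0_abs ?modz_ge0 //.
have := pairing_expX_sum_of (fun i : {x : gT & 'I_(c x)} => tag i) N fC q_pr.
rewrite /= -defu -/Q.
have [z1 ->] := exprD_mulz u v Q Q; have [z2 ->] := exprD_mulz u v Q (q ^ N).
rewrite !pairingD !pairingMz opprD addrACA -mulrBl.
by rewrite rpredDr //; apply: dvdz_mull; exact: dvdzz.
Qed.

End Pairing.

(** * Class functions at elements u with u^p = 1 *)

Section PrimeOrderUnits.
Variables (gT : finGroupType) (p : nat).
Hypothesis p_pr : prime p.
Implicit Types (u : grpRing int gT) (f : gT -> int).

Lemma class_funJ (T : Type) (f : gT -> T) x y : is_class_fun f -> f (x ^ y)%g = f x.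
Proof. by move=> fC; rewrite conjgE fC mulgK. Qed.

Lemma class_fun_expg (T : Type) (f : gT -> T) n :
  is_class_fun f -> is_class_fun (fun x => f (x ^+ n)%g).
Proof.
by move=> fC x y; rewrite -(class_funJ _ x fC) conjXg conjgE !mulgA mulVg mul1g.
Qed.

(** For N a multiple of [totient p] one has q^N = 1 modulo p, so [pairing_expX] says that q^(N+1)
    divides the difference [D] of the two sides; N is chosen so large that q^(N+1) exceeds |D|. *)
Lemma pairing_exp_prime f u q : u ^+ p = 1 -> is_class_fun f ->
  prime q -> q != p -> pairing f (u ^+ q) = pairing (fun x => f (x ^+ q)%g) u.
Proof.
move=> up1 fC q_pr qp; apply/eqP; rewrite -subr_eq0; apply/eqP.
set D := _ - _; pose k := `|D|%N; pose N := (totient p * k)%N.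
have qN1 : (q ^ N = 1 %[mod p])%N.
  rewrite /N expnM -modnXm Euler_exp_totient ?modnXm ?exp1n //.
  by rewrite prime_coprime // dvdn_prime2.
have: ((q ^ N.+1)%:Z %| D)%Z.
  have:= pairing_expX u N fC q_pr;
    rewrite -(expr_mod _ up1) -[u ^+ (q ^ N)](expr_mod _ up1).
  by rewrite expnS -modnMmr qN1 modnMmr muln1 !expr_mod // expr1.
rewrite dvdzE /= -/k => dvd_k; apply/eqP; rewrite -absz_eq0 -/k.
case: posnP => // k_gt0; have := dvdn_leq k_gt0 dvd_k.
rewrite leqNgt (leq_trans _ (ltnW (ltn_expl N.+1 (prime_gt1 q_pr)))) //.
by rewrite ltnS /N leq_pmull // totient_gt0 prime_gt0.
Qed.

Lemma pairing_exp_coprime f u j : u ^+ p = 1 -> is_class_fun f -> coprime j p ->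
  pairing f (u ^+ j) = pairing (fun x => f (x ^+ j)%g) u.
Proof.
move=> up1; have [n] := ubnP j; elim: n j f => // n IHn j f le_jn fC co_jp.
have [j_le1 | j_gt1] := leqP j 1.
  case: j j_le1 co_jp {le_jn} => [|[|//]] _ co_jp.
    by move: co_jp (prime_gt1 p_pr); rewrite /coprime gcd0n => /eqP->.
  by rewrite expr1; apply: eq_bigr => x _; rewrite expg1.
have q_pr := pdiv_prime j_gt1; have /dvdnP[i defj] := pdiv_dvd j.
move: co_jp; rewrite {1}defj coprimeMl => /andP[co_ip co_qp].
rewrite {1}defj exprM pairing_exp_prime //.
- rewrite IHn //; last exact: class_fun_expg.
    by apply: eq_bigr => x _; rewrite -expgM -defj.
  rewrite -ltnS; apply: leq_trans le_jn; rewrite ltnS [X in (_ < X)%N]defj.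
  rewrite ltn_Pmulr ?prime_gt1 //.
  by case: i defj {co_ip} j_gt1 => // ->.
- by rewrite exprAC up1 expr1n.
by apply: contraTneq co_qp => ->; rewrite prime_coprime // dvdnn.
Qed.

(** By the Chinese remainder theorem there is an exponent j for which x |-> x^j is the projection of
    G onto p-parts. *)
Lemma p_part_exponent :
  exists j, [/\ (j = 1 %[mod p])%N, forall x : gT, (p.-elt x)%g -> (x ^+ j)%g = x
                & forall x : gT, (p.-elt (x ^+ j))%g].
Proof.
pose n := #|[set: gT]|.
have co : coprime (n`_p * p) n`_p^'.
  by rewrite coprimeMl coprime_partC (@pnat_coprime p) ?part_pnat ?pnat_id.
(* The extra factor p ensures j = 1 modulo p even when p does not divide |G|. *)
pose j := chinese (n`_p * p) n`_p^' 1 0; exists j.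
have j1 : j = 1 %[mod n`_p * p] by apply: chinese_modl.
have j0 : j = 0 %[mod n`_p^'] by apply: chinese_modr.
split.
- by rewrite -(@modn_dvdm (n`_p * p) j) ?dvdn_mull // j1 modn_dvdm ?dvdn_mull.
- move=> x px; have dvd_x : (#[x]%g %| n`_p * p)%N.
    rewrite dvdn_mulr // -(part_pnat_id px) partn_dvd ?cardG_gt0 //.
    by apply: order_dvdG; rewrite inE.
  rewrite -(expg_mod_order x j) -(modn_dvdm _ dvd_x) j1 (modn_dvdm _ dvd_x).
  by rewrite expg_mod_order expg1.
move=> x; apply: (@pnat_dvd _ n`_p); last exact: part_pnat.
rewrite order_dvdn -expgM -order_dvdn.
apply: (@dvdn_trans n); first by apply: order_dvdG; rewrite inE.
rewrite -{1}(@partnC p n) ?cardG_gt0 // mulnC dvdn_mul //.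
by rewrite /dvdn j0 mod0n.
Qed.

(** For the exponent j of [p_part_exponent] one has u = u^j, so [f] and [f'] are only evaluated at
    the p-elements x^j. *)
Lemma eq_pairing_p_elt f f' u : u ^+ p = 1 -> is_class_fun f -> is_class_fun f' ->
  (forall x, (p.-elt x)%g -> f x = f' x) -> pairing f u = pairing f' u.
Proof.
move=> up1 fC f'C ff'; have [j [j1 xj xjp]] := p_part_exponent.
have co_jp : coprime j p by rewrite -coprime_modl j1 coprime_modl coprime1n.
have uj : u ^+ j = u by rewrite -(expr_mod _ up1) j1 expr_mod // expr1.
rewrite -[in LHS]uj -[in RHS]uj !pairing_exp_coprime //.
by apply: eq_bigr => x _; rewrite ff'.
Qed.
End PrimeOrderUnits.

(** * Ranks and traces of matrices of finite order *)

Section Ranks.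

(** In a full rank factorization e = C R, the equation e e = e forces R C = 1, and tr(C R) = tr(R
    C). *)
Lemma mxtrace_idempotent (F : fieldType) n (e : 'M[F]_n) :
  e *m e = e -> \tr e = (\rank e)%:R.
Proof.
have /row_fullP := col_base_full e; have /row_freeP := row_base_free e.
move: (col_base e) (row_base e) (mulmx_base e); move: (\rank e) => r C R <-.
move=> [D RD] [B BC] ee.
have RC1 : R *m C = 1%:M.
  have /(congr1 (fun A => B *m A *m D)) := ee; 
  by rewrite !mulmxA BC !mul1mx -[LHS]mulmxA RD mulmx1.
by rewrite mxtrace_mulC RC1 mxtrace1.
Qed.

Lemma mxtrace_scaled_idempotent (F : fieldType) n (c : F) (E : 'M[F]_n) :
  c != 0 -> E *m E = c *: E -> \tr E = c * (\rank E)%:R.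
Proof.
move=> c_nz EE; have /mxtrace_idempotent : (c^-1 *: E) *m (c^-1 *: E) = c^-1 *: E.
  by rewrite -scalemxAl -scalemxAr EE !scalerA mulrAC mulVf // mul1r.
by rewrite mxrank_scale_nz ?invr_eq0 // mxtraceZ => <-; rewrite mulVKf.
Qed.

Lemma mxrank_factor1 (F : fieldType) m n (A : 'M[F]_(m, n)) :
  exists U V, U *m A *m V = 1%:M :> 'M_(\rank A).
Proof.
have /row_fullP := col_base_full A; have /row_freeP := row_base_free A.
move: (col_base A) (row_base A) (mulmx_base A); move: (\rank A) => r C R <-.
by move=> [V RV] [U UC]; exists U, V; rewrite mulmxA UC mul1mx.
Qed.

(** Lift U and V with U A V = 1 modulo p to integer matrices: the determinant of the lifted product
    is nonzero modulo p, hence nonzero. *)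
Lemma mxrank_intr_Fp p m n (A : 'M[int]_(m, n)) : prime p ->
  (\rank (map_mx (intr : int -> 'F_p) A)
     <= \rank (map_mx (intr : int -> rat) A))%N.
Proof.
move=> p_pr; set Ap := map_mx _ A; set r := \rank Ap.
have [U [V UAV]] := mxrank_factor1 Ap.
pose lift a b (X : 'M['F_p]_(a, b)) := map_mx (fun x : 'F_p => (x : nat)%:Z) X.
have liftK a b (X : 'M['F_p]_(a, b)) : map_mx intr (lift a b X) = X.
  by apply/matrixP=> i j; rewrite !mxE /= -[RHS]natr_Zp.
pose B := lift _ _ U *m A *m lift _ _ V.
have detB : \det B != 0.
  have: \det (map_mx (intr : int -> 'F_p) B) != 0.
    by rewrite !map_mxM /= !liftK UAV det1 oner_eq0.
  by rewrite det_map_mx; apply: contraNneq => ->; rewrite rmorph0.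
have rankB : \rank (map_mx (intr : int -> rat) B) = r.
  by apply: mxrank_unit; rewrite unitmxE unitfE det_map_mx intr_eq0.
rewrite -{1}rankB !map_mxM /=.
by apply: leq_trans (mxrankM_maxl _ _) (mxrankM_maxr _ _).
Qed.

(* By Frobenius' rank inequality the ranks of the powers of A form a convex   *)
(* sequence. *)
Lemma mxrank_exp_chord (F : fieldType) n (A : 'M[F]_n) i j k : (i <= j <= k)%N ->
  ((k - i) * \rank (A ^+ j) <= (k - j) * \rank (A ^+ i) + (j - i) * \rank (A ^+ k))%N.
Proof.
pose r i := (\rank (A ^+ i))%:Z; pose d i := r i - r i.+1.
have d_step a : d a.+1 <= d a.
  have := mxrank_Frobenius A (A ^+ a) A; rewrite !mulmxE -exprS -exprSr -exprSr.
  by rewrite /d /r; lia.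
have d_mono a b : (a <= b)%N -> d b <= d a.
  move/subnK <-; elim: (b - a)%N => [|c IHc]; first by rewrite add0n.
  by apply: le_trans (d_step _) IHc.
case/andP=> le_ij le_jk.
have left_bound a c : c%:Z * d (a + c)%N <= r a - r (a + c)%N.
  elim: c => [|c IHc]; first by rewrite addn0 mul0r subrr.
  have := d_mono (a + c)%N _ (leqnSn _); rewrite -addnS => le_d.
  apply: le_trans (_ : c%:Z * d (a + c)%N + d (a + c)%N <= _); first nia.
  by move: IHc; rewrite {3}/d -addnS; lia.
have right_bound a c : r a - r (a + c)%N <= c%:Z * d a.
  elim: c => [|c IHc]; first by rewrite addn0 mul0r subrr.
  have := d_mono a (a + c)%N (leq_addr _ _).
  by move: IHc; rewrite {2}/d -addnS; lia.
have -> : (k - i = (j - i) + (k - j))%N by lia.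
have := left_bound i (j - i)%N; have := right_bound j (k - j)%N.
rewrite !subnKC // -lez_nat !(PoszD, PoszM) -/(r i) -/(r j) -/(r k).
move: (j - i)%N (k - j)%N (r i) (r j) (r k) (d j) => a b x y z t bt at_.
have := ler_wpM2l (ler0n int a) bt; have := ler_wpM2l (ler0n int b) at_.
by rewrite !natz; lia.
Qed.

(** Once the convex sequence of ranks, from n at 0 to 0 at m, is not below its chord at the single
    interior point m - a, it is nowhere below it; the conclusion is the cases 1 and m - 1. *)
Lemma mxrank_nilpotent (F : fieldType) n (A : 'M[F]_n) m a :
  (0 < a < m)%N -> A ^+ m = 0 -> (n * a <= m * \rank (A ^+ (m - a)))%N ->
  (n * (m - 1) <= m * \rank A)%N /\ (n <= m * \rank (A ^+ (m - 1)))%N.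
Proof.
case/andP=> a_gt0 lt_am Am0 le_rank; pose b := (m - a)%N.
have bE : (m = b + a)%N by rewrite subnK // ltnW.
have lower j : (j <= m)%N -> (n * (m - j) <= m * \rank (A ^+ j))%N.
  move=> le_jm; have [le_jb | lt_bj] := leqP j b.
    have := @mxrank_exp_chord _ _ A j b m; rewrite le_jb bE leq_addr => /(_ isT).
    rewrite -bE Am0 mxrank0 muln0 addn0 => chord.
    rewrite -(leq_pmul2l a_gt0); move: le_rank chord; rewrite -/b.
    have -> : (m - b = a)%N by rewrite bE addKn.
    by move: (\rank _) (\rank _) => r1 r2; nia.
  have := @mxrank_exp_chord _ _ A 0 b j; rewrite (ltnW lt_bj) => /(_ isT).
  rewrite !subn0 expr0 mxrank1 => chord.
  have b_gt0 : (0 < b)%N by rewrite subn_gt0.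
  rewrite -(leq_pmul2l b_gt0); move: le_rank chord; rewrite -/b.
  move: (\rank _) (\rank _) => r1 r2 h1 h2.
  have := leq_mul (leqnn j) h1; have := leq_mul (leqnn m) h2.
  have [c jE] : exists c, j = (b + c)%N by exists (j - b)%N; lia.
  have [e aE] : exists e, a = (c + e)%N by exists (a - c)%N; lia.
  have -> : (m - j = e)%N by lia.
  have -> : (j - b = c)%N by lia.
  by rewrite bE aE jE; nia.
split; last by have := lower (m - 1)%N (leq_subr _ _); rewrite subKn ?muln1; lia.
by have := lower 1%N; rewrite expr1; apply; lia.
Qed.

End Ranks.

(** * Traces of integer matrices of p-power order *)

Section IntegerMatrices.

Lemma polyX_sub1_exp_pchar (K : fieldType) p i : p \in [pchar K] ->
  ('X - 1) ^+ (p ^ i) = 'X^(p ^ i) - 1 :> {poly K}.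
Proof.
move=> pK; have p_nat : ([pchar {poly K}]).-nat (p ^ i)%N.
  rewrite pnatX (eq_pnat _ (@pchar_poly _)) (eq_pnat _ (pcharf_eq pK)).
  by rewrite pnat_id // (pcharf_prime pK).
by rewrite exprDn_pchar // exprNn_pchar // expr1n.
Qed.

Lemma polyX_sub1_exp_part (K : fieldType) p i k : p \in [pchar K] -> (i <= k)%N ->
  ('X - 1) ^+ (p ^ k - p ^ i) = \sum_(a < p ^ (k - i)) 'X^(p ^ i * a) :> {poly K}.
Proof.
move=> pK le_ik; have p_pr := pcharf_prime pK.
have nz : ('X^(p ^ i) - 1 : {poly K}) != 0.
  by rewrite -polyX_sub1_exp_pchar // expf_neq0 // polyXsubC_eq0.
apply: (mulfI nz); rewrite -{1}polyX_sub1_exp_pchar // -exprD subnKC; last first.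
  by rewrite leq_exp2l ?prime_gt1.
rewrite polyX_sub1_exp_pchar // -{1}(subnKC le_ik) expnD exprM subrX1.
by under [in RHS]eq_bigr => a _ do rewrite exprM.
Qed.

(** In characteristic p both norms are powers of the nilpotent matrix T - 1, with exponents m - p^k
    and m - 1, so [mxrank_nilpotent] applies with a = p^k. *)
Lemma mxrank_unipotent (K : fieldType) p k n (T : 'M[K]_n.+1) : p \in [pchar K] ->
    T ^+ (p ^ k.+1) = 1 ->
    (n.+1 <= p * \rank (\sum_(i < p) T ^+ (p ^ k * i))%R)%N ->
  let m := (p ^ k.+1)%N in
  (n.+1 * (m - 1) <= m * \rank (T - 1)%R)%N
  /\ (n.+1 <= m * \rank (\sum_(j < m) T ^+ j)%R)%N.
Proof.
move=> pK Tm1 le_rank m; have p_pr := pcharf_prime pK.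
have p_gt0 := prime_gt0 p_pr; have m_gt0 : (0 < m)%N by rewrite expn_gt0 p_gt0.
have hornerT : horner_mx T ('X - 1) = T - 1.
  by rewrite rmorphB /= horner_mx_X rmorph1.
have hornerTX i : horner_mx T 'X^i = T ^+ i by rewrite rmorphXn /= horner_mx_X.
have sumT : \sum_(j < m) T ^+ j = (T - 1) ^+ (m - 1).
  rewrite -hornerT -rmorphXn /= -{1}(expn0 p) polyX_sub1_exp_part // subn0 -/m.
  rewrite rmorph_sum /=; apply: eq_bigr => i _.
  by rewrite expn0 mul1n hornerTX.
rewrite sumT; apply: (@mxrank_nilpotent _ _ (T - 1) m (p ^ k)).
- by apply/andP; split; rewrite ?expn_gt0 ?p_gt0 // /m ltn_exp2l ?prime_gt1.
- rewrite -hornerT -rmorphXn /= polyX_sub1_exp_pchar // rmorphB /=.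
  by rewrite hornerTX rmorph1 Tm1 subrr.
rewrite -hornerT -rmorphXn /= polyX_sub1_exp_part // subSnn expn1 rmorph_sum /=.
under eq_bigr => i _ do rewrite hornerTX.
by rewrite /m expnS mulnAC leq_mul2r le_rank orbT.
Qed.

(** The rank bounds modulo p carry over to Q. There (T - 1) E = 0 for the norm E, so the ranks add
    up to at most n and both bounds are equalities; E E = m E then gives tr E = m rank E = n. *)
Lemma mxtrace_sum_powers p k n (T : 'M[int]_n) : prime p ->
  T ^+ (p ^ k.+1) = 1 ->
  (n <= p * \rank (map_mx (intr : int -> 'F_p) (\sum_(i < p) T ^+ (p ^ k * i))%R))%N ->
  \tr (\sum_(j < p ^ k.+1) T ^+ j) = n%:R.
Proof.
move=> p_pr; case: n T => [|n] T Tm1 le_rank; first by rewrite /mxtrace big_ord0.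
set m := (p ^ k.+1)%N in Tm1 *.
have p_gt0 := prime_gt0 p_pr; have m_gt0 : (0 < m)%N by rewrite expn_gt0 p_gt0.
pose Tp : 'M['F_p]_n.+1 := map_mx intr T; pose TQ : 'M[rat]_n.+1 := map_mx intr T.
have map_sum (R : comNzRingType) q (F : 'I_q -> nat) :
    map_mx intr (\sum_(i < q) T ^+ F i)
      = \sum_(i < q) (map_mx intr T : 'M[R]_n.+1) ^+ F i.
  by rewrite rmorph_sum; apply: eq_bigr => i _; rewrite rmorphXn.
have Tpm1 : Tp ^+ m = 1 by rewrite -rmorphXn /= Tm1 rmorph1.
have TQm1 : TQ ^+ m = 1 by rewrite -rmorphXn /= Tm1 rmorph1.
move: le_rank; rewrite map_sum => /(mxrank_unipotent (pchar_Fp p_pr) Tpm1).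
rewrite -/m => -[rankT rankE]; set E := \sum_(j < m) T ^+ j.
pose EQ : 'M[rat]_n.+1 := map_mx intr E.
have EQE : EQ = \sum_(j < m) TQ ^+ j by by exact: map_sum.
have rankEQ : (n.+1 <= m * \rank EQ)%N.
  apply: leq_trans rankE _; rewrite leq_mul2l; apply/orP; right.
  by apply: leq_trans (mxrank_intr_Fp E p_pr); rewrite /E map_sum.
have rankTQ : (n.+1 * (m - 1) <= m * \rank (TQ - 1)%R)%N.
  apply: leq_trans rankT _; rewrite leq_mul2l; apply/orP; right.
  have := mxrank_intr_Fp (T - 1) p_pr.
  by rewrite !rmorphB !rmorph1.
have TQE : (TQ - 1) * EQ = 0 by rewrite EQE -subrX1 TQm1 subrr.
have rank_sum := mulmx0_rank_max TQE.
have rankE_eq : (m * \rank EQ)%N = n.+1.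
  apply/eqP; rewrite eqn_leq rankEQ andbT; move: rankTQ rank_sum.
  by move: (\rank _) (\rank _) => r1 r2; nia.
have EQ2 : EQ * EQ = m%:R *: EQ.
  have TQiE i : TQ ^+ i * EQ = EQ.
    elim: i => [|i IHi]; first by rewrite mul1r.
    rewrite exprSr -mulrA; suff -> : TQ * EQ = EQ by [].
    by apply/eqP; rewrite -subr_eq0 -{2}[EQ]mul1r -mulrBl TQE.
  rewrite {1}EQE mulr_suml; under eq_bigr => i _ do rewrite TQiE.
  by rewrite sumr_const card_ord scaler_nat.
have m_nz : m%:R != 0 :> rat by rewrite pnatr_eq0 -lt0n.
have := mxtrace_scaled_idempotent m_nz EQ2.
rewrite trace_map_mx -natrM rankE_eq -[RHS]/((n.+1 : int)%:~R) => /intr_inj.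
by rewrite natz.
Qed.

End IntegerMatrices.

(** * Matrices of two-sided multiplications on the group ring *)

Section GroupMatrices.
Variable gT : finGroupType.
Implicit Types g h x y : gT.

Lemma grpRing_1E (R : nzRingType) x : (1 : grpRing R gT) x = (x == 1%g)%:R.
Proof. by rewrite [1]/(grpRing_of R 1%g) ffunE. Qed.

Section Ring.
Variable R : comNzRingType.
Implicit Types u v : grpRing R gT.

(* The matrix of the endomorphism x |-> g^-1 * x * u of R[gT]. *)
Definition grpmx g u : 'M[R]_#|gT| :=
  \matrix_(i, j) u ((enum_val i)^-1 * g * enum_val j)%g.

Lemma sum_enum_val (F : gT -> R) : \sum_(k < #|gT|) F (enum_val k) = \sum_x F x.
Proof. by rewrite -big_enum_val. Qed.

Lemma grpmxM g h u v : grpmx g u *m grpmx h v = grpmx (g * h)%g (u * v).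
Proof.
apply/matrixP=> i j; rewrite !mxE grpRing_mulE.
under eq_bigr => k _ do rewrite !mxE.
rewrite (sum_enum_val (fun z =>
  u ((enum_val i)^-1 * g * z)%g * v (z^-1 * h * enum_val j)%g)).
rewrite (reindex_inj (mulgI ((enum_val i)^-1 * g)^-1)%g) /=.
apply: eq_bigr => x _; rewrite mulKVg; congr (_ * v _).
by rewrite invMg invgK !mulgA.
Qed.

Lemma grpmx_sum g (I : Type) (r : seq I) (P : pred I) (F : I -> grpRing R gT) :
  grpmx g (\sum_(i <- r | P i) F i) = \sum_(i <- r | P i) grpmx g (F i).
Proof.
apply/matrixP=> i j; rewrite mxE sum_ffunE summxE.
by apply: eq_bigr => k _; rewrite mxE.
Qed.

Lemma grpmx1 : grpmx 1%g 1 = 1%:M.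
Proof.
apply/matrixP=> i j; rewrite !mxE grpRing_1E mulg1.
by rewrite -eq_mulVg1 (inj_eq enum_val_inj).
Qed.

Lemma grpmxX g u n : grpmx g u ^+ n = grpmx (g ^+ n)%g (u ^+ n).
Proof.
elim: n => [|n IHn]; first by rewrite !expr0 expg0 grpmx1.
by rewrite !exprS expgS IHn -mulmxE grpmxM.
Qed.

Lemma mxtrace_grpmx g u : \tr (grpmx g u) = \sum_x u (g ^ x)%g.
Proof.
rewrite /mxtrace -(sum_enum_val (fun x => u (g ^ x)%g)).
by apply: eq_bigr => i _; rewrite mxE conjgE mulgA.
Qed.

Lemma grpmx_inj : injective (grpmx 1%g).
Proof.
move=> u v /matrixP uv; apply/ffunP=> x.
by have := uv (enum_rank 1%g) (enum_rank x); rewrite !mxE !enum_rankK invg1 !mul1g.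
Qed.

(** Commuting with left translations means that the entry at (x, y) depends only on x^-1 y; the row
    at the identity then lists the coefficients of u. *)
Lemma grpmx_commute (B : 'M[R]_#|gT|) :
  (forall g, grpmx g 1 *m B = B *m grpmx g 1) -> exists u, B = grpmx 1%g u.
Proof.
move=> cB; pose b x y := B (enum_rank x) (enum_rank y).
have bM g x y : b (g^-1 * x)%g y = b x (g * y)%g.
  have /matrixP/(_ (enum_rank x) (enum_rank y)) := cB g; rewrite !mxE.
  rewrite (bigD1 (enum_rank (g^-1 * x)%g)) //= big1 => [|k kx]; last first.
    rewrite mxE grpRing_1E enum_rankK -eq_invg_mul invMg invgK.
    by rewrite eq_sym (can2_eq enum_valK enum_rankK) (negPf kx) mul0r.
  rewrite mxE grpRing_1E !enum_rankK -mulgA mulKVg mulVg eqxx mul1r addr0.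
  rewrite -/(b _ _) => ->.
  rewrite (bigD1 (enum_rank (g * y)%g)) //= big1 => [|k kx]; last first.
    rewrite mxE grpRing_1E enum_rankK -mulgA -eq_mulVg1.
    by rewrite (can2_eq enum_valK enum_rankK) (negPf kx) mulr0.
  rewrite mxE grpRing_1E !enum_rankK -mulgA mulVg eqxx mulr1 addr0.
  by [].
exists [ffun x => b 1%g x]; apply/matrixP=> i j; rewrite mxE ffunE mulg1.
by rewrite -bM invgK mulg1 /b !enum_valK.
Qed.

End Ring.

Definition grpRing_map (R S : nzRingType) (phi : R -> S) (u : grpRing R gT) :
  grpRing S gT := [ffun x => phi (u x)].

Lemma map_grpmx (R S : comNzRingType) (phi : {rmorphism R -> S}) g (u : grpRing R gT) :
  map_mx phi (grpmx g u) = grpmx g (grpRing_map phi u).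
Proof. by apply/matrixP=> i j; rewrite !mxE ffunE. Qed.

Lemma grpRing_map1 (R S : comNzRingType) (phi : {rmorphism R -> S}) :
  grpRing_map phi (1 : grpRing R gT) = 1.
Proof. by apply/ffunP=> x; rewrite ffunE !grpRing_1E rmorph_nat. Qed.

(** This norm is the incidence matrix of lying in the same right coset of <[g]>; on a set of coset
    representatives it restricts to an identity matrix of size |G|/p. *)
Lemma mxrank_cyclic_norm (K : fieldType) p g : #[g]%g = p ->
  (#|gT| <= p * \rank (\sum_(i < p) grpmx (g ^+ i)%g (1 : grpRing K gT))%R)%N.
Proof.
move=> og; set N := \sum_(i < p) _.
have NE i j : N i j = (enum_val i * (enum_val j)^-1 \in <[g]>)%g%:R.
  rewrite summxE; under eq_bigr => k _ do rewrite mxE.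
  set xi := enum_val i; set xj := enum_val j.
  transitivity (\sum_(k < p) ((g ^+ k)%g == xi * xj^-1)%g%:R : K).
    apply: eq_bigr => k _; rewrite grpRing_1E -mulgA.
    by rewrite -eq_mulVg1 eq_sym (can2_eq (mulgK xj) (mulgKV xj)).
  have [/cyclePmin[k lt_k ->]|not_in] := boolP (_ \in _).
    rewrite og in lt_k; rewrite (bigD1 (Ordinal lt_k)) //= eqxx.
    rewrite big1 ?addr0 // => l; rewrite -val_eqE /= => lk.
    by rewrite eq_expg_mod_order og !modn_small // (negPf lk).
  rewrite big1 // => k _; case: eqP => // gk.
  by rewrite -gk mem_cycle in not_in.
pose f (a : 'I_#|rcosets <[g]> [set: gT]|) := enum_rank (repr (enum_val a)).
have f1 : rowsub f 1%:M *m N *m colsub f 1%:M = 1%:M.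
  rewrite -rowsubE mulmx_colsub mulmx1; apply/matrixP=> a b;
    rewrite !mxE NE !enum_rankK.
  rewrite -mem_rcoset; congr (nat_of_bool _)%:R.
  have /imsetP[x _ defx] := enum_valP a; have /imsetP[y _ defy] := enum_valP b.
  rewrite rcosetE in defx; rewrite rcosetE in defy.
  rewrite -(inj_eq enum_val_inj) defx defy.
  by rewrite (sameP rcoset_eqP eqP) !rcoset_repr.
apply: leq_trans (leq_mul (leqnn p) (mulmx1_min_rank f1)).
by rewrite -og -[#[g]%g]/#|<[g]>|%g Lagrange ?subsetT // cardsT.
Qed.

End GroupMatrices.

(** * Partial augmentations of units of prime order *)

Section TorsionUnits.
Variables (gT : finGroupType) (p : nat).
Hypothesis p_pr : prime p.
Implicit Types (u : grpRing int gT) (g x y : gT).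

(** This is |C_G(g)| times the indicator of the class of g; with this scaling the pairing with u is
    the trace of [grpmx g u]. *)
Definition conj_count g x : int := #|[set y | (g ^ y == x)%g]|%:Z.

Lemma conj_countC g : is_class_fun (conj_count g).
Proof.
move=> x y; congr (_%:Z); rewrite -(card_imset _ (mulIg x)).
apply: eq_card => z; rewrite !inE; apply/imsetP/idP => [[t]|/eqP gz].
  by rewrite inE => /eqP gt ->; rewrite conjgM gt conjgE !mulgA mulVg mul1g.
exists (z * x^-1)%g; last by rewrite mulgKV.
by rewrite inE conjgM gz conjgE invgK !mulgA mulgK.
Qed.

Lemma pairing_conj_count g u : pairing (conj_count g) u = \sum_y u (g ^ y)%g.
Proof.
rewrite (partition_big (fun y => g ^ y)%g predT) //=; apply: eq_bigr => x _.
rewrite (eq_bigr (fun=> u x)) => [|y /eqP-> //].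
rewrite sumr_const -mulr_natr natz; congr (_ * _%:Z).
by apply: eq_card => y; rewrite inE.
Qed.

Lemma sum_conj_exp g u j : u ^+ p = 1 -> (p.-elt g)%g -> coprime j p ->
  \sum_y (u ^+ j) ((g ^+ j) ^ y)%g = \sum_y u (g ^ y)%g.
Proof.
move=> up1 pg co_jp; rewrite -!pairing_conj_count.
rewrite (pairing_exp_coprime p_pr up1) //; last exact: conj_countC.
apply: (eq_pairing_p_elt p_pr up1); first exact/class_fun_expg/conj_countC.
  exact: conj_countC.
move=> x px; congr (_%:Z); apply: eq_card => y; rewrite !inE conjXg.
pose n := (#|[set: gT]|`_p)%N; have co_nj : coprime n j.
  by rewrite (@pnat_coprime p) ?part_pnat // p'natE // -prime_coprime // coprime_sym.
(* Raising to the power [c], a multiple of j, is the identity on p-elements of G, so the j-th power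
   map is injective on them. *)
pose c := chinese n j 1 0; have /dvdnP[i defc] : (j %| c)%N.
  by rewrite /dvdn chinese_modr // mod0n.
have c1 (z : gT) : (p.-elt z)%g -> (z ^+ c)%g = z.
  move=> pz; have dvd_n : (#[z]%g %| n)%N.
    rewrite /n -(part_pnat_id pz) partn_dvd ?cardG_gt0 //.
    by apply: order_dvdG; rewrite inE.
  rewrite -(expg_mod_order z c) -(modn_dvdm _ dvd_n) chinese_modl //.
  by rewrite (modn_dvdm _ dvd_n) expg_mod_order expg1.
apply/eqP/eqP => [eq_j | -> //].
have pgy : (p.-elt (g ^ y))%g by rewrite p_eltJ.
by rewrite -(c1 _ pgy) -(c1 _ px) defc mulnC !expgM eq_j.
Qed.

(** Let T be [grpmx g u] and |g| = p^(k+1). Since k > 0, u^(p^k) = 1 and T^(p^k) is translation by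
    an element of order p, so [mxtrace_sum_powers] evaluates the sum of the traces of all T^j as
    |G|. *)
Lemma sum_conj_p_elt g u : u ^+ p = 1 -> (p.-elt g)%g -> (p ^ 2 %| #[g]%g)%N ->
  \sum_y u (g ^ y)%g = 0.
Proof.
move=> up1 pg p2g; set s := \sum_y _.
have [[|k] og] := p_natP pg.
  move: p2g; rewrite og dvdn1 (gtn_eqF _) // -(expn0 p) ltn_exp2l ?prime_gt1 //.
have p_gt0 := prime_gt0 p_pr; set m := (p ^ k.+1)%N in og.
have m_gt1 : (1 < m)%N by rewrite -(expn0 p) ltn_exp2l ?prime_gt1.
have upk i : (p %| i)%N -> u ^+ i = 1.
  by case/dvdnP=> j ->; rewrite mulnC exprM up1 expr1n.
have k_gt0 : (0 < k)%N.
  by move: p2g; rewrite og /m dvdn_Pexp2l ?(prime_gt1 p_pr) ?ltnS.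
have := @mxtrace_sum_powers p k _ (grpmx g u) p_pr.
rewrite -/m grpmxX -{1}og expg_order upk ?dvdn_exp // grpmx1 => /(_ erefl).
have og' : #[(g ^+ (p ^ k))%g]%g = p.
  by rewrite orderXdiv og /m ?dvdn_exp2l // expnS mulnK // expn_gt0 p_gt0.
have -> : map_mx (intr : int -> 'F_p) (\sum_(i < p) grpmx g u ^+ (p ^ k * i))
   = \sum_(i < p) grpmx ((g ^+ (p ^ k)) ^+ i)%g 1.
  rewrite raddf_sum; apply: eq_bigr => i _.
  rewrite /= grpmxX expgM upk ?map_grpmx ?grpRing_map1 //.
  by rewrite dvdn_mulr // dvdn_exp.
move=> /(_ (mxrank_cyclic_norm _ og')); rewrite raddf_sum /=.
under eq_bigr => j _ do rewrite grpmxX mxtrace_grpmx.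
rewrite (bigD1 (Ordinal (ltnW m_gt1))) //=.
under eq_bigr => y _ do rewrite expr0 expg0 conj1g grpRing_1E eqxx.
rewrite sumr_const => /eqP; rewrite -subr_eq0 addrAC subrr add0r.
(* The exponent 0 already accounts for |G|. The other multiples j of p give translations by g^j !=
   1, of trace 0; all remaining exponents give trace [s]. *)
rewrite (bigID (fun j : 'I_m => coprime j p)) /= [X in _ + X]big1 => [|j]; last first.
  rewrite coprime_sym prime_coprime // negbK -val_eqE /= => /andP[j0 pj].
  apply: big1 => y _; rewrite upk // grpRing_1E.
  rewrite -(conj1g y) (inj_eq (conjg_inj y)) -order_dvdn og.
  by rewrite gtnNdvd ?lt0n.
rewrite (eq_bigr (fun=> s)) => [|j /andP[_ co_j]]; last exact: sum_conj_exp.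
rewrite sumr_const !addr0 mulrn_eq0 => /orP[/eqP/card0_eq|/eqP//].
by move/(_ (Ordinal m_gt1)); rewrite unfold_in -val_eqE coprime1n.
Qed.

Lemma augmentationM (R : comNzRingType) (u v : grpRing R gT) :
  augmentation (u * v) = augmentation u * augmentation v.
Proof.
rewrite /augmentation mulr_suml; under eq_bigr => g _ do rewrite grpRing_mulE.
rewrite exchange_big; apply: eq_bigr => h _ /=; rewrite -mulr_sumr; congr (_ * _).
by rewrite (reindex_inj (mulgI h)); apply: eq_bigr => g _; rewrite mulKg.
Qed.

Lemma augmentation1 (R : comNzRingType) : augmentation (1 : grpRing R gT) = 1.
Proof.
rewrite /augmentation (bigD1 1%g) //= grpRing_1E eqxx big1 ?addr0 // => g /negPf g1.
by rewrite grpRing_1E g1.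
Qed.

Lemma augmentationX (R : comNzRingType) (u : grpRing R gT) n :
  augmentation (u ^+ n) = augmentation u ^+ n.
Proof.
elim: n => [|n IHn]; first by rewrite !expr0 augmentation1.
by rewrite !exprS augmentationM IHn.
Qed.

Lemma augmentation_sum (R : comNzRingType) (I : Type) (r : seq I) (P : pred I)
    (F : I -> grpRing R gT) :
  augmentation (\sum_(i <- r | P i) F i) = \sum_(i <- r | P i) augmentation (F i).
Proof.
by rewrite /augmentation exchange_big; apply: eq_bigr => g _; rewrite sum_ffunE.
Qed.

(** The norm E = 1 + u + ... + u^(p-1) satisfies E E = p E, and the p - 1 nontrivial powers of u
    have equal traces, so n (1 + (p-1) u(1)) = p rank E. *)
Lemma berman_higman u : u ^+ p = 1 -> u != 1 -> augmentation u = 1 -> u 1%g = 0.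
Proof.
move=> up1 u1 augu; have p_gt0 := prime_gt0 p_pr; set n := #|gT|.
have n_gt0 : (0 < n)%N by apply/card_gt0P; exists 1%g.
pose E := \sum_(j < p) u ^+ j.
have uE : u * E = E by apply/eqP;
  rewrite -subr_eq0 -{2}[E]mul1r -mulrBl -subrX1 up1 subrr.
have ujE j : u ^+ j * E = E by elim: j => [|j IHj]; rewrite ?mul1r // exprSr -mulrA uE.
pose EQ := map_mx (intr : int -> rat) (grpmx 1%g E).
have EQ2 : EQ *m EQ = p%:R *: EQ.
  rewrite -map_mxM grpmxM mulg1 {1}/E mulr_suml grpmx_sum.
  under eq_bigr => j _ do rewrite ujE.
  by rewrite sumr_const card_ord scaler_nat raddfMn.
have p_nz : p%:R != 0 :> rat by rewrite pnatr_eq0 -lt0n.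
have trE : \tr (grpmx 1%g E) = n%:Z + (p.-1)%:Z * (n%:Z * u 1%g).
  rewrite grpmx_sum raddf_sum /= (bigD1 (Ordinal p_gt0)) //=.
  under eq_bigr => j _ do rewrite mxtrace_grpmx.
  congr (_ + _).
    rewrite mxtrace_grpmx; under eq_bigr => y _ do rewrite conj1g grpRing_1E eqxx.
    by rewrite sumr_const natz.
  rewrite (eq_bigr (fun=> n%:Z * u 1%g)) => [|j j0].
    by rewrite sumr_const cardC1 card_ord -mulr_natl natz.
  have j_gt0 : (0 < j)%N by rewrite lt0n.
  rewrite -{1}(expg1n gT j) sum_conj_exp ?p_elt1 //; last first.
    by rewrite coprime_sym prime_coprime // gtnNdvd.
  under eq_bigr => y _ do rewrite conj1g.
  by rewrite sumr_const -mulr_natl natz.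
have := mxtrace_scaled_idempotent p_nz EQ2; rewrite trace_map_mx trE.
rewrite -natrM -[RHS]/((p * \rank EQ)%:Z%:~R) => /intr_inj tr_rank.
have rank_le : (\rank EQ <= n)%N := rank_leq_row _.
have rank_gt0 : (0 < \rank EQ)%N.
  rewrite lt0n mxrank_eq0; apply/negP => /eqP EQ0.
  have E0 : E = 0.
    apply: (@grpmx_inj gT int); apply/matrixP=> i j.
    move/matrixP/(_ i j): EQ0; rewrite !mxE ffunE => /eqP.
    by rewrite intr_eq0 => /eqP.
  have := congr1 (@augmentation _ _) E0; rewrite augmentation_sum.
  under eq_bigr => j _ do rewrite augmentationX augu expr1n.
  rewrite sumr_const card_ord /augmentation big1 => [|x _]; last by rewrite ffunE.
  by move/eqP; rewrite pnatr_eq0 eqn0Ngt p_gt0.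
have p_gt1 := prime_gt1 p_pr.
(* Rank strictly between 0 and n gives 0 < 1 + (p-1) u(1) < p, so u(1) = 0. Full rank makes E the
   scalar p, and then u E = E yields u = 1. *)
have [rank_n | rank_n] := eqVneq (\rank EQ) n; last first.
  have rank_lt : (\rank EQ < n)%N by rewrite ltn_neqAle rank_n.
  have [q pE] : exists q, p = q.+2 by exists p.-2; lia.
  move: tr_rank rank_gt0 rank_lt; rewrite pE.
  move: (\rank _) (u 1%g) (n) n_gt0 => r k m m_gt0 /= tr_r r_gt0 r_lt.
  have tr_pos : (0 < m%:Z * (1 + q.+1%:Z * k))%R by nia.
  have tr_lt : (m%:Z * (1 + q.+1%:Z * k) < m%:Z * q.+2%:Z)%R by nia.
  move: tr_pos tr_lt; rewrite pmulr_rgt0 ?ltr_pM2l ?ltz_nat //.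
  by nia.
have EQ_unit : EQ \in unitmx by rewrite -row_full_unit /row_full rank_n.
have EQp : EQ = p%:R%:M.
  by rewrite -[EQ](mulKmx EQ_unit) EQ2 -scalemxAr mulVmx // scale_scalar_mx mulr1.
have Ep : E = 1 *+ p.
  apply/ffunP=> x; have /matrixP/(_ (enum_rank 1%g) (enum_rank x)) := EQp.
  rewrite !mxE !enum_rankK invg1 !mul1g (inj_eq enum_rank_inj) ffunMnE
    grpRing_1E eq_sym.
  move=> Ex; apply: (@intr_inj rat); rewrite Ex rmorphMn rmorph_nat.
  by case: (x == 1%g); rewrite ?mulr0n ?mul0rn ?mulr1n.
case/eqP: u1; apply/ffunP=> x; move/ffunP/(_ x): uE.
rewrite Ep mulrnAr mulr1 !ffunMnE => /eqP; rewrite -subr_eq0 -mulrnBl mulrn_eq0.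
by rewrite eqn0Ngt p_gt0 /= subr_eq0 => /eqP.
Qed.

(** Subtract c to get h vanishing on elements of order p. Averaging over conjugation writes |G|
    times the pairing of h as a combination of the sums of u over conjugates of g, which vanish
    unless g has order p. *)
Lemma pairing_eq_on_order_p f c u :
  u ^+ p = 1 -> u != 1 -> augmentation u = 1 -> is_class_fun f ->
  (forall x, #[x]%g = p -> f x = c) -> pairing f u = c.
Proof.
move=> up1 u1 augu fC fc; pose h x := f x - c.
have hC : is_class_fun h by move=> x y; rewrite /h fC.
suff: pairing h u = 0.
  move/eqP; rewrite /pairing /h; under eq_bigr => x _ do rewrite mulrBr.
  by rewrite big_split /= sumrN -mulr_suml -[X in X * c]/(augmentation u) augu
    mul1r subr_eq0 => /eqP.
have: pairing h u *+ #|gT| = \sum_g h g * \sum_y u (g ^ y)%g.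
  under [RHS]eq_bigr => g _ do rewrite mulr_sumr.
  rewrite exchange_big /= -sumr_const; apply: eq_bigr => y _.
  rewrite (reindex_inj (conjg_inj y^-1)%g) /=; apply: eq_bigr => x _.
  by rewrite conjgKV class_funJ // mulrC.
rewrite big1 => [/eqP|g _].
  rewrite mulrn_eq0 => /orP[/eqP/card0_eq/(_ 1%g)|/eqP//]; by rewrite inE.
have [og | neq_p] := eqVneq #[g]%g p; first by rewrite /h fc // subrr mul0r.
suff -> : \sum_y u (g ^ y)%g = 0 by rewrite mulr0.
(* For g = 1 use [berman_higman], for a p-element of order at least p^2 use [sum_conj_p_elt];
   otherwise [conj_count g] vanishes on all p-elements. *)
have [pg | n_pg] := boolP (p.-elt g)%g.
  have [[|[|k]] og] := p_natP pg; last 2 first.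
  - by rewrite og expn1 eqxx in neq_p.
  - by apply: sum_conj_p_elt => //; rewrite og dvdn_exp2l.
  move/eqP: og; rewrite expn0 order_eq1 => /eqP->.
  by rewrite big1 // => y _; rewrite conj1g berman_higman.
rewrite -pairing_conj_count (@eq_pairing_p_elt _ _ p_pr _ (fun=> 0)) //.
- by rewrite /pairing big1 // => x _; rewrite mulr0.
- exact: conj_countC.
move=> x px; rewrite /conj_count (_ : [set _ | _] = set0) ?cards0 //.
apply/setP=> y; rewrite !inE; apply: contraNF n_pg => /eqP gy.
by rewrite -(p_eltJ p g y) gy.
Qed.

End TorsionUnits.

(** * Rational conjugacy *)

Section RationalDescent.
Variable n : nat.

Lemma exists_nat_nonroot (P : {poly algC}) : P != 0 -> exists k : nat, P.[k%:R] != 0.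
Proof.
move=> P0; pose s := [seq k%:R : algC | k <- iota 0 (size P)].
have s_uniq : uniq s by rewrite map_inj_uniq ?iota_uniq // => i j /eqP;
  rewrite eqr_nat => /eqP.
have := max_poly_roots P0 _ s_uniq; rewrite size_map size_iota ltnn.
case: (boolP (all (root P) s)) => [_ /(_ isT) // | /allPn[z /mapP[k _ ->] Pk] _].
by exists k.
Qed.

(** The coefficients [b i] are replaced by natural numbers one at a time and absorbed into [C]: the
    determinant is a polynomial in each coefficient, nonzero at [b i], hence nonzero at some natural
    number. *)
Lemma descend_invertible (S : 'M[rat]_n -> Prop) (I : Type) (s : seq I)
    (b : I -> algC) (B : I -> 'M[rat]_n) (C : 'M[rat]_n) :
  (forall D E, S D -> S E -> S (D + E)) -> (forall (k : nat) D, S D -> S (k%:R *: D)) ->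
  S C -> (forall i, S (B i)) ->
  \det (map_mx ratr C + \sum_(i <- s) b i *: map_mx ratr (B i)) != 0 ->
  exists2 D, S D & D \in unitmx.
Proof.
move=> SD SZ SC SB; elim: s C SC => [|i s IHs] C SC.
  rewrite big_nil addr0 det_map_mx fmorph_eq0 => detC; by exists C;
    rewrite // unitmxE unitfE.
rewrite big_cons addrCA; set Z := map_mx ratr C + _ => detZ.
pose P := \det ('X *: map_mx (polyC \o ratr) (B i) + map_mx polyC Z).
have Pz z : P.[z] = \det (z *: map_mx ratr (B i) + Z).
  rewrite -[LHS]/(horner_eval z P) -det_map_mx; congr (\det _).
  by apply/matrixP=> j k; rewrite !mxE /= /horner_eval !hornerE.
have P0 : P != 0.
  by apply: contraNneq detZ => P0; rewrite -Pz P0 horner0.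
have [k] := exists_nat_nonroot P0; rewrite Pz => detk.
apply: (IHs (C + k%:R *: B i)); first by apply: SD => //; apply: SZ.
by rewrite map_mxD map_mxZ /= ratr_nat addrAC addrC.
Qed.

(* An invertible intertwiner over algC has entries in a number field; its     *)
(* coordinates over a rational basis of that field are rational intertwiners. *)
Lemma rational_intertwiner (X : Type) (M N : X -> 'M[rat]_n) (B : 'M[algC]_n) :
  B \in unitmx ->
  (forall x, map_mx ratr (M x) *m B = B *m map_mx ratr (N x)) ->
  exists2 D, D \in unitmx & forall x, M x *m D = D *m N x.
Proof.
move=> Bu BMN.
have [L [LC [s Bs _]]] :=
  num_field_exists [seq B ij.1 ij.2 | ij <- enum {: 'I_n * 'I_n}].
pose B1 : 'M[L]_n := \matrix_(i, j) s`_(index (i, j) (enum {: 'I_n * 'I_n})).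
have BE : B = map_mx LC B1.
  apply/matrixP=> i j; rewrite !mxE.
  have lt_ij : (index (i, j) (enum {: 'I_n * 'I_n}) < size s)%N.
    by rewrite -(size_map LC) Bs size_map index_mem mem_enum.
  rewrite -(nth_map 0 0) // Bs (nth_map (i, j)) ?nth_index ?mem_enum //.
  by rewrite index_mem mem_enum.
move: B1 BE => B1 BE;
  have LC_rat a : LC a%:A = ratr a by rewrite alg_num_field fmorph_rat.
have B1MN x : map_mx (in_alg L) (M x) *m B1 = B1 *m map_mx (in_alg L) (N x).
  have map_in_alg (A : 'M[rat]_n) : map_mx ratr A = map_mx LC (map_mx (in_alg L) A).
    by apply/matrixP=> i j; rewrite !mxE /= LC_rat.
  have := BMN x; rewrite BE !map_in_alg -!map_mxM => /matrixP eqLC.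
  by apply/matrixP=> i j; have := eqLC i j; rewrite !mxE => /fmorph_inj.
pose bas := vbasis {:L}.
pose Bj (j : 'I_(\dim {:L})) : 'M[rat]_n := map_mx (coord bas j) B1.
pose S (D : 'M[rat]_n) := forall x, M x *m D = D *m N x.
have [D SD Du] : exists2 D, S D & D \in unitmx; last by exists D.
apply: (@descend_invertible S _ (index_enum _)
  (fun j : 'I_(\dim {:L}) => LC bas`_j) Bj 0).
- by move=> D E SD SE x; rewrite mulmxDr mulmxDl SD SE.
- by move=> k D SD x; rewrite -scalemxAr -scalemxAl SD.
- by move=> x; rewrite mulmx0 mul0mx.
(* Coordinates are Q-linear, so they commute with multiplication by the rational matrices [M x] and
   [N x]. *)
- move=> j x; apply/matrixP=> i k; have /matrixP/(_ i k) := B1MN x.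
  rewrite !mxE => /(congr1 (coord bas j)); rewrite !linear_sum /=.
  have termE (a : rat) (l : L) : coord bas j (a%:A * l) = a * coord bas j l.
    by rewrite -scalerAl mul1r linearZ.
  under eq_bigr => l _ do rewrite mxE termE.
  under [X in _ = X -> _]eq_bigr => l _ do rewrite mxE mulrC termE mulrC.
  move=> eqE; under eq_bigr => l _ do rewrite mxE.
  by rewrite eqE; apply: eq_bigr => l _; rewrite mxE.
suff -> : map_mx ratr 0 + \sum_(j < \dim {:L}) LC bas`_j *: map_mx ratr (Bj j) = B.
  by rewrite -unitfE -unitmxE.
rewrite map_mx0 add0r BE; apply/matrixP=> i k; rewrite summxE !mxE.
rewrite [B1 i k in RHS](coord_vbasis (memvf _)) rmorph_sum.
apply: eq_bigr => j _; rewrite !mxE -LC_rat -rmorphM /=.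
by rewrite -scalerAr mulr1.
Qed.

End RationalDescent.

(** * Equal characters imply conjugacy by a unit of QH *)

Section RationalConjugacy.
Variables (hT aT : finGroupType) (A : {group aT}).

Definition grp_hom (alpha : aT -> grpRing rat hT) :=
  alpha 1%g = 1 /\ {in A &, forall a b, alpha (a * b)%g = alpha a * alpha b}.

Lemma grpmx_repr alpha : grp_hom alpha ->
  mx_repr (setX_group [set: hT]%G A)
    (fun x : hT * aT => map_mx (ratr : rat -> algC) (grpmx x.1 (alpha x.2))).
Proof.
case=> alpha1 alphaM; split=> [|[h a] [k b]] /=.
  by rewrite alpha1 grpmx1 map_mx1.
by rewrite !inE /= => Aa Ab; rewrite alphaM // -map_mxM grpmxM.
Qed.

(** Let H act on QH by left translations and A by right multiplication through [alpha] or [beta].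
    The hypothesis equates the characters of H x A, so there is a rational intertwiner; commuting
    with H, it is right multiplication by a unit w. *)
Lemma rational_conjugacy alpha beta : grp_hom alpha -> grp_hom beta ->
    (forall a h, a \in A -> \sum_y alpha a (h ^ y)%g = \sum_y beta a (h ^ y)%g) ->
  exists2 w, w \is a GRing.unit & {in A, forall a, beta a = w^-1 * alpha a * w}.
Proof.
move=> homA homB eq_sum; pose G := setX_group [set: hT]%G A.
have : mx_rsim (MxRepresentation (grpmx_repr homA))
               (MxRepresentation (grpmx_repr homB)).
  apply/cfRepr_inj/cfun_inP => -[h a]; rewrite inE /= => /andP[_ Aa].
  by rewrite !cfunE !inE Aa /= !trace_map_mx !mxtrace_grpmx eq_sum.
case=> B _; rewrite row_free_unit => Bu BG.
have [|D Du DG] := @rational_intertwiner _ {x : hT * aT | x \in G}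
    (fun x => grpmx (val x).1 (alpha (val x).2))
    (fun x => grpmx (val x).1 (beta (val x).2)) B Bu.
  by case=> x Gx; apply: BG.
have DGa h a : a \in A -> grpmx h (alpha a) *m D = D *m grpmx h (beta a).
  move=> Aa; have Gha : (h, a) \in G by rewrite !inE.
  exact: (DG (exist _ (h, a) Gha)).
have cD h : grpmx h 1 *m D = D *m grpmx h 1.
  by have := DGa h 1%g (group1 A); rewrite homA.1 homB.1.
have cDV h : grpmx h 1 *m invmx D = invmx D *m grpmx h 1.
  by rewrite -[LHS](mulKmx Du) [D *m _]mulmxA -cD -[_ *m D *m _]mulmxA mulmxV // mulmx1.
have [w defD] := grpmx_commute cD; have [w' defDV] := grpmx_commute cDV.
have ww' : w * w' = 1.
  apply: (@grpmx_inj hT rat); rewrite grpmx1 -[1%g in LHS](mulg1 1%g) -grpmxM.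
  by rewrite -defD -defDV mulmxV.
have w'w : w' * w = 1.
  apply: (@grpmx_inj hT rat); rewrite grpmx1 -[1%g in LHS](mulg1 1%g) -grpmxM.
  by rewrite -defD -defDV mulVmx.
have wu : w \is a GRing.unit by apply/unitrP; exists w'.
exists w => // a Aa; apply: (mulrI wu); rewrite -mulrA mulVKr //.
apply: (@grpmx_inj hT rat); rewrite -[1%g](mulg1 1%g) -!grpmxM -defD.
by rewrite DGa.
Qed.

End RationalConjugacy.

(** * The regular embedding of G in Sym(G) *)

Section RegularEmbedding.
Variable gT : finGroupType.

Definition regular_perm (g : gT) : {perm gT} := perm (mulIg g).

Lemma regular_permM : {in [set: gT] &, {morph regular_perm : g h / (g * h)%g}}.
Proof. by move=> g h _ _; apply/permP=> x; rewrite permM !permE mulgA. Qed.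

Definition regular_morph : {morphism [set: gT] >-> {perm gT}} := Morphism regular_permM.

Lemma injm_regular : ('injm regular_morph)%g.
Proof.
by apply/injmP=> g h _ _ /permP/(_ 1%g); rewrite !permE !mul1g.
Qed.

(** Left cosets of <[g]> are the cycles of right multiplication by g; the coordinates are the cycle
    and the position in it. *)
Lemma cycle_coordinates p (g : gT) : #[g]%g = p -> (0 < p)%N ->
  exists2 phi : 'I_(#|gT| %/ p) * 'I_p -> gT, bijective phi &
    forall a i, (phi (a, i) * g)%g = phi (a, ordS i).
Proof.
move=> og p_gt0; pose L := lcosets <[g]>%g [set: gT].
have cardL : #|L| = (#|gT| %/ p)%N.
  by rewrite /L card_lcosets -divgS ?subsetT // cardsT -og.
rewrite -cardL; pose phi (ai : 'I_#|L| * 'I_p) := (repr (enum_val ai.1) * g ^+ ai.2)%g.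
have coset_phi a i : (phi (a, i) *: <[g]>)%g = enum_val a.
  have /lcosetsP[x _ defx] := enum_valP a.
  rewrite /phi /= lcosetM lcoset_id ?mem_cycle // defx.
  exact/lcoset_eqP/(mem_repr x (lcoset_refl <[g]> x)).
exists phi.
  apply: inj_card_bij; last first.
    by rewrite card_prod !card_ord cardL divnK // -og -cardsT order_dvdG ?inE.
  move=> [a i] [b j] eq_phi.
  have ab : a = b by apply: enum_val_inj; rewrite -(coset_phi a i) eq_phi coset_phi.
  move: eq_phi; rewrite ab => /mulgI/eqP;
    rewrite eq_expg_mod_order og !modn_small // => /eqP ij.
  by congr (_, _); apply: val_inj.
move=> a i; rewrite /phi /= -mulgA -expgSr; congr (_ * _)%g.
by rewrite -[LHS](expg_mod_order g) og.
Qed.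

(** Both permutations have |G|/p cycles of length p, and matching the cycle coordinates conjugates
    one into the other. *)
Lemma regular_conjugate p (g h : gT) : (0 < p)%N -> #[g]%g = p -> #[h]%g = p ->
  exists s, (regular_morph g ^ s)%g = regular_morph h.
Proof.
move=> p_gt0 og oh.
have [phi [phi' phiK phi'K] phiM] := cycle_coordinates og p_gt0.
have [psi [psi' psiK psi'K] psiM] := cycle_coordinates oh p_gt0.
have sI : injective (psi \o phi').
  by apply: inj_comp; [apply: can_inj psiK | apply: can_inj phi'K].
exists (perm sI); apply: (mulgI (perm sI)); rewrite conjgE !mulgA mulgV mul1g.
apply/permP=> x; rewrite !permM !permE /=.
have [[a i] ->] : exists ai, x = phi ai by exists (phi' x).
by rewrite phiM !phiK psiM.
Qed.

End RegularEmbedding.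

(** * Groups of p-rank one *)

Section RankOne.
Local Open Scope group_scope.
Variables (gT : finGroupType) (p : nat).
Hypothesis p_pr : prime p.
Hypothesis rank1 : ('r_p([set: gT]) <= 1)%N.
Implicit Types (P D : {group gT}) (x y : gT).

(** Compare both with a central subgroup <[z]> of order p of P: <[t]> <*> <[z]> is elementary
    abelian, so by the rank bound it has order at most p. *)
Lemma rank1_cyclic_unique P x y : p.-group P -> x \in P -> y \in P ->
  #[x] = p -> #[y] = p -> <[x]> = <[y]>.
Proof.
move=> pP Px Py ox oy.
have ntP : P :!=: 1 by apply/trivgPn; exists x => //; rewrite -order_gt1 ox prime_gt1.
have ntZ : 'Z(P) != 1 by rewrite (center_nil_eq1 (pgroup_nil pP)).
have [_ pZ _] := pgroup_pdiv (pgroupS (center_sub P) pP) ntZ.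
have [z Zz oz] := Cauchy p_pr pZ.
suff eq_z t : t \in P -> #[t] = p -> <[t]> = <[z]> by rewrite (eq_z x) ?(eq_z y).
move=> Pt ot; have czt : <[z]> \subset 'C(<[t]>).
  by apply: cents_cycle; have /centerP[_ /(_ t Pt)] := Zz.
have abelE : p.-abelem (<[t]> <*> <[z]>).
  by rewrite (cprod_abelem p (cprodEY czt)) !prime_abelem.
have: (<[t]> <*> <[z]>)%G \in 'E_p([set: gT]) by rewrite inE abelE subsetT.
move/logn_le_p_rank/leq_trans/(_ rank1) => le1.
have le_p : (#|<[t]> <*> <[z]>| <= p)%N.
  rewrite (card_pgroup (abelem_pgroup abelE)) -[p in X in (_ <= X)%N]expn1.
  by rewrite leq_exp2l ?prime_gt1.
transitivity (<[t]> <*> <[z]>); last apply/esym.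
  by apply/eqP; rewrite eqEcard joing_subl -[#|<[t]>|]/(#[t]) ot.
by apply/eqP; rewrite eqEcard joing_subr -[#|<[z]>|]/(#[z]) oz.
Qed.

Lemma rank1_Ohm1 P c : p.-group P -> c \in P -> #[c] = p -> 'Ohm_1(P) = <[c]>.
Proof.
move=> pP Pc oc; apply/eqP; rewrite eqEsubset Ohm1Eprime gen_subG; apply/andP; split.
  apply/subsetP=> x; rewrite inE => /andP[Px x_pr].
  suff eq_xc : <[x]> = <[c]> by rewrite /= -eq_xc cycle_id.
  apply: (rank1_cyclic_unique pP) => //; have := mem_p_elt pP Px.
  by rewrite /p_elt pnatE // => /eqP.
by rewrite cycle_subG mem_gen // inE Pc oc.
Qed.

Lemma rank1_cyclic_conjugate x c : #[x] = p -> #[c] = p -> exists y, <[x]> = <[c]> :^ y.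
Proof.
move=> ox oc; have [P sylP] := Sylow_exists p [set: gT].
have pcycle (t : gT) : #[t] = p -> p.-group <[t]> by move=> ot;
  rewrite /pgroup -orderE ot pnat_id.
have [y _ sxP] := Sylow_Jsub sylP (subsetT _) (pcycle x ox).
have [z _ scP] := Sylow_Jsub sylP (subsetT _) (pcycle c oc).
exists (z * y^-1); rewrite conjsgM; apply: (canRL (conjsgK y)).
rewrite -!cycleJ; apply: (rank1_cyclic_unique (pHall_pgroup sylP)).
- by rewrite -cycle_subG cycleJ.
- by rewrite -cycle_subG cycleJ.
- by rewrite orderJ.
by rewrite orderJ.
Qed.

(* A Sylow subgroup permutes the conjugates of <[c]> other than <[c]> itself *)
(* semiregularly. *)
Lemma rank1_card_normaliser P c : p.-Sylow([set: gT]) P -> c \in P -> #[c] = p ->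
  exists t, #|[set: gT]| = (#|'N(<[c]>)| * (1 + t * #|P|))%N.
Proof.
move=> sylP Pc oc; have pP := pHall_pgroup sylP; set Z := <[c]>%G.
have pcycle (t : gT) : #[t] = p -> p.-group <[t]>.
  by move=> ot; rewrite /pgroup -orderE ot pnat_id.
have ZP y : y \in P -> Z :^ y = Z.
  move=> Py; rewrite /= -cycleJ; apply: (rank1_cyclic_unique pP) => //.
    by rewrite groupJ.
  by rewrite orderJ.
pose S := (Z :^: [set: gT]) :\ (Z : {set gT}).
have actsS : [acts P, on S | 'Js].
  apply/subsetP=> y Py; apply/astabsP=> D /=; rewrite !inE -{1}(ZP y Py).
  by rewrite (inj_eq (@conjsg_inj _ y)) -!orbitJs (orbit_actr 'Js) ?inE.
have orbit_card T : T \in orbit 'Js P @: S -> #|T| = #|P|.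
  case/imsetP=> D; rewrite !inE => /andP[DZ /imsetP[g _ defD]] ->.
  (* A nontrivial stabiliser in P contains <[c]>, so <[c]> normalises D and together they generate a
     p-group; its subgroup of order p is unique, whence D = <[c]>. *)
  rewrite (card_orbit 'Js) astab1Js; suff -> : 'N_P(D) = 1 by rewrite indexg1.
  apply/trivgP; apply: contraNT DZ; rewrite subG1 => ntN.
  have pN : p.-group 'N_P(D) by apply: pgroupS pP; apply: subsetIl.
  have [_ p_dvd _] := pgroup_pdiv pN ntN.
  have [y /setIP[Py Dy] oy] := Cauchy p_pr p_dvd.
  have sZN : <[c]> \subset 'N(D).
    by rewrite (rank1_cyclic_unique pP Pc Py) // cycle_subG.
  have defD' : D = <[c ^ g]> by rewrite defD cycleJ.
  have ocg : #[c ^ g] = p by rewrite orderJ.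
  have pDZ : p.-group (<[c ^ g]> <*> <[c]>).
    by rewrite norm_joinEr ?pgroupM ?pcycle //= -defD'.
  rewrite defD' eq_sym; apply/eqP; apply: (rank1_cyclic_unique pDZ) => //.
    by rewrite (subsetP (joing_subr _ _)) ?cycle_id.
  by rewrite (subsetP (joing_subl _ _)) ?cycle_id.
have := acts_sum_card_orbit actsS.
rewrite (eq_bigr (fun=> #|P|)) // sum_nat_const => cardS.
have ZS : (Z : {set gT}) \in Z :^: [set: gT] by apply/imsetP; exists 1;
  rewrite ?inE ?conjsg1.
exists #|orbit 'Js P @: S|; rewrite cardS.
have := cardsD1 (Z : {set gT}) (Z :^: [set: gT]); rewrite ZS -/S => <-.
rewrite card_conjugates -[in X in (X * _)%N](setTI 'N(_)) mulnC.
by rewrite -divgS ?subsetIl // divnK // cardSg ?subsetIl.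
Qed.

Lemma rank1_pgroup_structure P : p.-group P -> P :!=: 1 ->
  exists x k, [/\ x \in P, #[x] = (p ^ k.+1)%N
    & #|P| = (p ^ k.+1)%N \/
      [/\ p = 2%N, (0 < k)%N, #|P| = (p ^ k.+2)%N
        & exists y, x ^ y = x^-1 /\ y ^+ 2 = x ^+ (p ^ k)]].
Proof.
move=> pP ntP; have [_ p_dvd _] := pgroup_pdiv pP ntP.
have [c Pc oc] := Cauchy p_pr p_dvd.
have /(prime_Ohm1P pP ntP) : #|'Ohm_1(P)| = p by rewrite (rank1_Ohm1 pP Pc oc) -orderE.
case/orP=> [/cyclicP[x defP] | /andP[/eqP p2 /eqP/quaternion_classP[n n_gt2 isoP]]].
  have [[|k] oP] := p_natP pP; first by rewrite trivg_card1 oP in ntP.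
  by exists x, k; split; [rewrite defP cycle_id | rewrite orderE -defP | left].
have [[x y] genP [_ y2 xy]] := generators_quaternion n_gt2 isoP.
(* The quaternion group has order 2^n and x has order 2^(n-1), so k + 1 = n - 1. *)
have [oP Px ox _] := genP; exists x, n.-2.
have [n_gt0 n1_gt0] : (0 < n /\ 0 < n.-1)%N by case: n n_gt2 {isoP genP oP ox
  y2} => [|[]].
rewrite p2 !prednK //; split=> //; right; split=> //; last by exists y.
by case: n n_gt2 {isoP genP oP ox y2 n_gt0 n1_gt0} => [|[|[]]].
Qed.

End RankOne.

(** * Noncyclic groups of units of order p^2 *)

Lemma sum_multiples (V : nmodType) d m (G : nat -> V) : (0 < d)%N ->
  \sum_(i < d * m | (d %| i)%N) G i = \sum_(j < m) G (d * j)%N.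
Proof.
move=> d_gt0; have lt1 (j : 'I_m) : (d * j < d * m)%N by rewrite ltn_pmul2l.
have lt2 (i : 'I_(d * m)) : (i %/ d < m)%N by rewrite ltn_divLR // [(m * d)%N]mulnC.
rewrite (reindex_onto (fun j => Ordinal (lt1 j)) (fun i => Ordinal (lt2 i))) /=.
  apply: eq_bigl => j; rewrite dvdn_mulr //=; apply/eqP/val_inj.
  by rewrite /= mulKn.
by move=> i dvd_i; apply/val_inj; rewrite /= [LHS]mulnC divnK.
Qed.

Section ElementaryAbelianUnits.
Variables (gT aT : finGroupType) (p : nat) (A : {group aT}).
Variable alpha : aT -> grpRing int gT.
Hypotheses (p_pr : prime p) (abelA : (p.-abelem A)%g) (cardA : #|A| = (p ^ 2)%N).
Hypothesis alphaM : {in A &, forall a b, alpha (a * b)%g = alpha a * alpha b}.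
Hypothesis alpha1 : alpha 1%g = 1.
Hypothesis alpha_neq1 : {in A, forall a, a != 1%g -> alpha a != 1}.
Hypothesis alpha_aug : {in A, forall a, augmentation (alpha a) = 1}.
Hypothesis rank1 : ('r_p([set: gT])%g <= 1)%N.

Let n := #|gT|.
(** [u] is p^2 times the idempotent e, and [S g] is the trace of h |-> g^-1 h u on ZG. *)
Let u := \sum_(a in A) alpha a.
Let S g := \sum_y u (g ^ y)%g.

Let alphaX a j : a \in A -> alpha (a ^+ j)%g = alpha a ^+ j.
Proof.
move=> Aa; elim: j => [|j IHj]; first by rewrite expg0 expr0.
by rewrite expgS exprS alphaM ?groupX // IHj.
Qed.

Let alphaXp a : a \in A -> alpha a ^+ p = 1.
Proof. by move=> Aa; have [_ Ap] := abelemP p_pr abelA; rewrite -alphaX // Ap. Qed.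

Let sum_u g : S g = \sum_(a in A) \sum_y alpha a (g ^ y)%g.
Proof. by rewrite exchange_big; apply: eq_bigr => y _; rewrite sum_ffunE. Qed.

Let pairing_alpha f c a : a \in A -> a != 1%g -> is_class_fun f ->
  (forall x, #[x]%g = p -> f x = c) -> pairing f (alpha a) = c.
Proof.
by move=> Aa a1 fC fc; apply: (@pairing_eq_on_order_p _ p);
  rewrite ?alphaXp ?alpha_neq1 ?alpha_aug.
Qed.

Let S1 : S 1%g = n%:Z.
Proof.
rewrite sum_u (bigD1 1%g) //= [X in _ + X]big1 => [|a /andP[Aa a1]].
  rewrite addr0 alpha1; under eq_bigr => y _ do rewrite conj1g grpRing_1E eqxx.
  by rewrite sumr_const natz.
rewrite big1 // => y _; rewrite conj1g.
by apply: (berman_higman p_pr); rewrite ?alphaXp ?alpha_neq1 ?alpha_aug.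
Qed.

Let S_other g : g != 1%g -> #[g]%g != p -> S g = 0.
Proof.
move=> g1 gp; rewrite sum_u big1 // => a Aa.
have [-> | a1] := eqVneq a 1%g.
  rewrite alpha1 big1 // => y _; rewrite grpRing_1E.
  by rewrite -(conj1g y) (inj_eq (@conjg_inj _ y)) (negPf g1).
rewrite -pairing_conj_count; apply: pairing_alpha => //; first exact: conj_countC.
move=> x ox; rewrite /conj_count (_ : [set _ | _] = set0) ?cards0 //.
apply/setP=> y; rewrite !inE; apply: contraNF gp => /eqP gy.
by rewrite -(orderJ g y) gy ox.
Qed.

Let S_exp c j : #[c]%g = p -> coprime j p -> S (c ^+ j)%g = S c.
Proof.
move=> oc co_jp; rewrite !sum_u.
have co_Aj : coprime #|A| j by rewrite cardA coprimeXl // coprime_sym.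
rewrite (reindex_onto (fun a => a ^+ j)%g (fun a => a ^+ expg_invn A j)%g) /=;
  last first.
  by move=> a Aa; rewrite -expgM mulnC expgM expgK.
have in_A a : ((a ^+ j)%g \in A) && (((a ^+ j) ^+ expg_invn A j)%g == a) = (a \in A).
  apply/andP/idP=> [[Aaj /eqP <-] | Aa]; first exact: groupX.
  by rewrite groupX // expgK.
rewrite (eq_bigl _ _ in_A); apply: eq_bigr => a Aa; rewrite alphaX //.
by rewrite (sum_conj_exp p_pr) ?alphaXp // /p_elt oc pnat_id.
Qed.

(** Some j contributes for y exactly when x lies in <[c ^ y]>, and then only one does. Since <[x]>
    and <[c]> are conjugate, these y form a coset of the normaliser. *)
Let card_conj_cycle (c x : gT) : #[c]%g = p -> #[x]%g = p ->
  \sum_(j < p | val j != 0%N) conj_count (c ^+ j)%g x = #|'N(<[c]>)%g|%:Z.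
Proof.
move=> oc ox; have [z defx] := rank1_cyclic_conjugate p_pr rank1 ox oc.
have x1 : x != 1%g by rewrite -order_gt1 ox prime_gt1.
have p_gt0 := prime_gt0 p_pr.
rewrite -natz; under eq_bigr => j _ do rewrite /conj_count -natz.
rewrite -natr_sum; congr _%:R.
under eq_bigr => j _ do rewrite -sum1_card big_mkcond /=.
rewrite exchange_big /= -(card_rcoset 'N(<[c]>)%g z) -sum1_card [RHS]big_mkcond /=.
apply: eq_bigr => y _; under eq_bigr => j _ do rewrite inE conjXg.
have ocy : #[(c ^ y)%g]%g = p by rewrite orderJ.
have -> : (y \in 'N(<[c]>) :* z)%g = (x \in <[c ^ y]>)%g.
  rewrite mem_rcoset; apply/normP/idP => [Nyz | x_cy].
    have -> : (<[c ^ y]> = <[x]>)%g by rewrite cycleJ defx -{2}Nyz -conjsgM mulgKV.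
    exact: cycle_id.
  rewrite conjsgM; apply: (canLR (conjsgK z)); rewrite -defx -cycleJ.
  apply/esym/eqP; rewrite eqEcard cycle_subG x_cy.
  by rewrite -!orderE ox ocy /=.
case: ifP => [/cyclePmin[j lt_j defxj] | x_cy].
  rewrite ocy in lt_j; have j0 : j != 0%N by apply: contraNneq x1 => j0;
    rewrite defxj j0.
  rewrite (bigD1 (Ordinal lt_j)) //= -defxj eqxx big1 // => i /andP[_].
  rewrite -val_eqE /= defxj eq_expg_mod_order ocy !modn_small //.
  by move/negPf->.
by rewrite big1 // => j _; case: eqP => // cyj; rewrite -cyj mem_cycle in x_cy.
Qed.

(** Sum S over the nontrivial powers of c in two ways: all terms equal S c, while each of the p^2 -
    1 nontrivial elements of A contributes |N(<[c]>)|. Divide by p - 1. *)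
Let S_p (c : gT) : #[c]%g = p -> S c = (p.+1 * #|'N(<[c]>)%g|)%N%:Z.
Proof.
move=> oc; have p_gt1 := prime_gt1 p_pr; have p_gt0 := ltnW p_gt1.
have sumS : \sum_(j < p | val j != 0%N) S (c ^+ j)%g = p.-1%:Z * S c.
  rewrite (eq_bigr (fun=> S c)) => [|j j0]; last first.
    by rewrite S_exp // coprime_sym prime_coprime // gtnNdvd // lt0n.
  rewrite sumr_const -mulr_natl natz; congr (_%:Z * _).
  rewrite (eq_card (_ : _ =i predC1 (Ordinal p_gt0))); first by rewrite cardC1 card_ord.
  by move=> j; rewrite !inE.
have sumS' : \sum_(j < p | val j != 0%N) S (c ^+ j)%g = (p ^ 2).-1%:Z *
  #|'N(<[c]>)%g|%:Z.
  under eq_bigr => j _ do rewrite sum_u.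
  rewrite exchange_big (bigD1 1%g) //= alpha1 big1 ?add0r => [|j j0]; last first.
    rewrite big1 // => y _; rewrite grpRing_1E -(conj1g y) (inj_eq (@conjg_inj _ y)).
    by rewrite -order_dvdn oc gtnNdvd // lt0n.
  rewrite (eq_bigr (fun=> #|'N(<[c]>)%g|%:Z)) => [|a /andP[Aa a1]].
    rewrite sumr_const -mulr_natl natz -cardA (cardD1 1%g A) group1.
    by congr (_%:Z * _); apply: eq_card => a; rewrite !inE andbC.
  under eq_bigr => j _ do rewrite -pairing_conj_count.
  rewrite /pairing exchange_big /=; under eq_bigr => x _ do rewrite -mulr_sumr.
  apply: pairing_alpha => //; last by move=> x; apply: card_conj_cycle.
  by move=> x y; apply: eq_bigr => j _; apply: conj_countC.
have p1_nz : p.-1%:Z != 0 by rewrite eqz_nat -lt0n -subn1 subn_gt0.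
apply: (mulfI p1_nz); rewrite -sumS sumS' -!PoszM; congr _%:Z.
by rewrite mulnA; congr (_ * _)%N; case: (p) p_gt0 => // q _;
  rewrite -[(q.+1 ^ 2)%N]mulnn; nia.
Qed.

Let Mc g (v : grpRing int gT) : 'M[algC]_n := map_mx intr (grpmx g v).
Let E := Mc 1%g u.

Let McM g h v w : Mc g v *m Mc h w = Mc (g * h)%g (v * w).
Proof. by rewrite -map_mxM grpmxM. Qed.

Let trMc g v : \tr (Mc g v) = (\sum_y v (g ^ y)%g)%:~R.
Proof. by rewrite trace_map_mx mxtrace_grpmx. Qed.

Let uu : u * u = u *+ p ^ 2.
Proof.
rewrite {1}/u mulr_suml -cardA -sumr_const; apply: eq_bigr => a Aa.
rewrite /u mulr_sumr [RHS](reindex_inj (mulgI a)) /=.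
by apply: eq_big => [b | b Ab]; rewrite ?groupMl // alphaM.
Qed.

Let EE : E *m E = (p ^ 2)%:R *: E.
Proof. 
rewrite McM mulg1 uu scaler_nat; apply/matrixP=> i j.
by rewrite mulmxnE !mxE ffunMnE rmorphMn.
Qed.

Lemma card_dvd_p2 : (p ^ 2 %| n)%N.
Proof.
have p2_nz : (p ^ 2)%:R != 0 :> algC by rewrite pnatr_eq0 expn_eq0 eqn0Ngt prime_gt0.
have := mxtrace_scaled_idempotent p2_nz EE; rewrite trMc -/(S 1%g) S1 -natrM => /eqP.
by rewrite eqC_nat => /eqP->; rewrite dvdn_mulr.
Qed.

(** * Multiplicity of a faithful linear character of a cyclic p-subgroup *)

Section Eigenspace.
Variables (x c : gT) (k : nat) (mu : algC).
Let q := (p ^ k.+1)%N.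
Hypotheses (ox : #[x]%g = q) (mu_prim : q.-primitive_root mu) (oc : #[c]%g = p).

Let X := Mc x 1.
Let Y := mu^-1 *: X.
(* Up to a scalar, Phi is the projection of C[G] onto the mu-eigenspace of x *)
(* in C[G] * u. *)
Let F := \sum_(i < q) Y ^+ i.
Let Phi := F *m E.

Let mu_nz : mu != 0.
Proof. by rewrite (prim_root_eq0 mu_prim) expn_eq0 eqn0Ngt prime_gt0. Qed.

Let XX i : X ^+ i = Mc (x ^+ i)%g 1.
Proof.
elim: i => [|i IHi]; first by rewrite expr0 expg0 /Mc grpmx1 map_mx1.
by rewrite exprS IHi -mulmxE McM expgS mulr1.
Qed.

Let YX i : Y ^+ i = mu ^- i *: Mc (x ^+ i)%g 1.
Proof.
rewrite -XX; elim: i => [|i IHi]; first by rewrite !expr0 invr1 scale1r.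
rewrite !exprS IHi -!mulmxE -scalemxAl -scalemxAr scalerA; congr (_ *: _).
by rewrite invfM.
Qed.

Let Yq : Y ^+ q = 1.
Proof. by rewrite YX (prim_expr_order mu_prim) invr1 scale1r -ox expg_order
  -(expg0 x) -XX. Qed.

Let FX : F *m X = mu *: F.
Proof.
have FY : F * Y = F.
  apply/eqP; rewrite -subr_eq0 -{2}[F]mulr1 -mulrBr.
  have cY1 : GRing.comm F (Y - 1).
    apply: commrB; last exact: commr1.
    by apply/commr_sym/commr_sum => i _; apply/commrX.
  by rewrite cY1 -subrX1 Yq subrr.
by rewrite -{2}FY /Y -mulmxE -scalemxAr scalerA divff // scale1r.
Qed.

Let cXE : X *m E = E *m X.
Proof. by rewrite !McM mul1g mulg1 mul1r mulr1. Qed.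

Let PhiX : Phi *m X = mu *: Phi.
Proof. by rewrite -mulmxA -cXE mulmxA FX -scalemxAl. Qed.

Let PhiE : Phi *m E = (p ^ 2)%:R *: Phi.
Proof. by rewrite -mulmxA EE -scalemxAr. Qed.

(** With [W := Phi] this makes [Phi] a scaled idempotent; for general [W] it places the rows of [W]
    in the row space of [Phi]. *)
Let eigen_Phi m (W : 'M_(m, n)) : W *m X = mu *: W -> W *m E = (p ^ 2)%:R *: W ->
  W *m Phi = (q * p ^ 2)%:R *: W.
Proof.
move=> WX WE; have WYi i : W *m (Y ^+ i) = W.
  elim: i => [|i IHi]; first by rewrite mulmx1.
  by rewrite exprS -mulmxE mulmxA /Y -scalemxAr WX scalerA mulVf // scale1r.
rewrite mulmxA mulmx_sumr; under eq_bigr => i _ do rewrite WYi.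
by rewrite sumr_const card_ord -scaler_nat -scalemxAl WE scalerA natrM.
Qed.

Let S_order_p g : #[g]%g = p -> S g = (p.+1 * #|'N(<[c]>)%g|)%N%:Z.
Proof.
move=> og; have [z defg] := rank1_cyclic_conjugate p_pr rank1 og oc.
by rewrite S_p // defg normJ cardJg.
Qed.

(** Only the x^i with p^k dividing i have order 1 or p and contribute; the coefficients of those of
    order p are the nontrivial p-th roots of unity, with sum -1. *)
Let trPhi : \tr Phi = n%:R - (p.+1 * #|'N(<[c]>)%g|)%:R.
Proof.
have p_gt0 := prime_gt0 p_pr; have pk_gt0 : (0 < p ^ k)%N by rewrite expn_gt0 p_gt0.
have qE : q = (p ^ k * p)%N by rewrite /q expnSr.
have -> : \tr Phi = \sum_(i < q) mu ^- i * (S (x ^+ i)%g)%:~R.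
  rewrite /Phi mulmx_suml raddf_sum; apply: eq_bigr => i _ /=.
  by rewrite YX -scalemxAl mxtraceZ McM mulg1 mul1r trMc.
rewrite (bigID (fun i : 'I_q => p ^ k %| i)%N) /=.
rewrite [X in _ + X]big1 ?addr0 => [|i pki]; last first.
  rewrite S_other ?mulr0 //; apply: contra pki.
    by rewrite -order_dvdn ox => /(dvdn_trans _)->; rewrite ?dvdn_exp2l.
  move/eqP=> oxi; have := expg_order (x ^+ i)%g; rewrite oxi -expgM => /eqP.
  by rewrite -order_dvdn ox {1}qE dvdn_pmul2r.
have -> : \sum_(i < q | (p ^ k %| i)%N) mu ^- i * (S (x ^+ i)%g)%:~R
        = \sum_(j < p) mu ^- (p ^ k * j) * (S (x ^+ (p ^ k * j))%g)%:~R.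
  have := sum_multiples p (fun i => mu ^- i * (S (x ^+ i)%g)%:~R) pk_gt0.
  by rewrite -qE.
have sum_roots : \sum_(j < p) mu ^- (p ^ k * j) = 0.
  have z1 : mu ^- (p ^ k) != 1.
    rewrite invr_eq1 -(prim_order_dvd mu_prim) /q dvdn_Pexp2l ?prime_gt1 //.
    by rewrite ltnn.
  under eq_bigr => j _ do rewrite exprM -exprVn.
  have := subrX1 (mu ^- (p ^ k)) p;
    rewrite exprVn -exprM -qE (prim_expr_order mu_prim) invr1.
  by rewrite subrr => /esym/eqP; rewrite mulf_eq0 subr_eq0 (negPf z1) => /eqP.
move: sum_roots; rewrite (bigD1 (Ordinal p_gt0)) //= muln0 expr0 invr1 => /eqP.
rewrite addr_eq0 => /eqP roots1.
rewrite (bigD1 (Ordinal p_gt0)) //= muln0 expr0 invr1 expg0 S1 mul1r.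
rewrite (eq_bigr (fun j : 'I_p =>
  mu ^- (p ^ k * j) * (p.+1 * #|'N(<[c]>)%g|)%:R)) => [|j j0].
  by rewrite -mulr_suml -[X in X * _]opprK -roots1 mulN1r.
rewrite S_order_p // expgM orderXgcd orderXdiv ox /q ?dvdn_exp2l // expnS mulnK //.
have /eqP -> : coprime p j by rewrite prime_coprime // gtnNdvd // lt0n.
by rewrite divn1.
Qed.

Let rank_Phi :
  (n = p.+1 * #|'N(<[c]>)%g| + q * p ^ 2 * \rank Phi)%N.
Proof.
have nz : (q * p ^ 2)%:R != 0 :> algC.
  by rewrite pnatr_eq0 muln_eq0 !expn_eq0 eqn0Ngt prime_gt0.
have := mxtrace_scaled_idempotent nz (eigen_Phi PhiX PhiE).
rewrite trPhi => /eqP; rewrite subr_eq -natrM -natrD eqC_nat => /eqP nE.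
by rewrite [LHS]nE addnC.
Qed.

(* For v in the mu-eigenspace of x let J v be the complex conjugate of v y:    *)
(* as x and y are real matrices, J preserves this eigenspace; it is           *)
(* antilinear with J^2 = -1, so |det J|^2 = (-1)^r. *)
Let rank_Phi_even y : (x ^ y = x^-1)%g -> (y ^+ 2 = x ^+ (p ^ k))%g ->
  p = 2%N -> ~~ odd (\rank Phi).
Proof.
move=> xy y2 p2; set r := \rank Phi.
have q_gt0 : (0 < q)%N by rewrite expn_gt0 prime_gt0.
pose V := Mc y 1; pose B : 'M_(r, n) := row_base Phi;
  pose cj := Num.conj : algC -> algC.
have B_free : row_free B by exact: row_base_free.
have B_Phi : (B :=: Phi)%MS by exact: eq_row_base.
clearbody B; have XVX : X *m V *m X = V.
  rewrite !McM !mulr1; congr (Mc _ _).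
  have -> : (x * y = y * x^-1)%g by rewrite -xy conjgE mulKVg.
  by rewrite mulgKV.
have cV : V *m E = E *m V by rewrite !McM mul1g mulg1 mul1r mulr1.
have VV : V *m V = X ^+ (p ^ k) by rewrite McM mulr1 XX -y2.
have /submxP[D defB] : (B <= Phi)%MS by rewrite B_Phi.
have BX : B *m X = mu *: B by rewrite defB -mulmxA PhiX -scalemxAr.
have BE : B *m E = (p ^ 2)%:R *: B by rewrite defB -mulmxA PhiE -scalemxAr.
have cjMc g v : map_mx cj (Mc g v) = Mc g v.
  by apply/matrixP=> i j; rewrite !mxE /cj rmorph_int.
have cj_mu : cj mu = mu^-1.
  have: `|mu| == 1.
    by rewrite -(pexpr_eq1 q_gt0) // -normrX (prim_expr_order mu_prim) normr1.
  by move/eqP=> mu1; rewrite invC_norm mu1 expr1n invr1 mul1r.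
have cjK m1 m2 (Z : 'M[algC]_(m1, m2)) : map_mx cj (map_mx cj Z) = Z.
  by apply/matrixP=> i j; rewrite !mxE /cj conjCK.
(* [C] is the matrix of J in the basis [B] of the eigenspace. *)
have /submxP[C defC] : (map_mx cj (B *m V) <= B)%MS.
  rewrite B_Phi.
  have WX : map_mx cj (B *m V) *m X = mu *: map_mx cj (B *m V).
    have BVX : B *m V *m X = mu^-1 *: (B *m V).
      apply: (scalerI mu_nz); rewrite scalerA divff // scale1r !scalemxAl -BX.
      by rewrite -[in RHS]XVX !mulmxA.
    rewrite -{1}[X](cjMc x 1) -map_mxM BVX map_mxZ; congr (_ *: _).
    by rewrite -cj_mu; apply: conjCK.
  have WE : map_mx cj (B *m V) *m E = (p ^ 2)%:R *: map_mx cj (B *m V).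
    rewrite -{1}[E](cjMc 1%g u) -map_mxM -mulmxA cV mulmxA BE -scalemxAl map_mxZ.
    by rewrite /cj rmorph_nat.
  have nz : (q * p ^ 2)%:R != 0 :> algC.
    by rewrite pnatr_eq0 muln_eq0 !expn_eq0 eqn0Ngt prime_gt0.
  rewrite -(eqmx_scale _ nz) -(eigen_Phi WX WE); exact: submxMl.
have BV : B *m V = map_mx cj C *m map_mx cj B.
  by rewrite -map_mxM -defC cjK.
have mu_half : mu ^+ (p ^ k) = -1.
  have /eqP : (mu ^+ (p ^ k)) ^+ 2 = 1.
    by rewrite -exprM -[2%N in LHS]p2 -expnSr (prim_expr_order mu_prim).
  rewrite sqrf_eq1 -(prim_order_dvd mu_prim) /q dvdn_Pexp2l ?prime_gt1 // ltnn.
  by move/eqP.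
have BXi i : B *m X ^+ i = mu ^+ i *: B.
  elim: i => [|i IHi]; first by rewrite mulmx1 scale1r.
  by rewrite !exprSr -mulmxE mulmxA IHi -scalemxAl BX scalerA.
(* J^2 is the action of y^2 = x^(p^k) on the eigenspace, which is mu^(p^k) = -1. *)
have CC : map_mx cj C *m C = - 1%:M.
  apply: (row_free_inj B_free).
  rewrite mulNmx mul1mx -scaleN1r -mu_half -BXi -VV mulmxA BV -!mulmxA; congr (_ *m _).
  by rewrite -defC map_mxM cjMc.
have: \det (map_mx cj C *m C) = (-1) ^+ r.
  by rewrite CC -scaleN1r detZ det1 mulr1.
rewrite det_mulmx det_map_mx /cj mulrC -normCK => norm_det.
apply/negP=> r_odd; have := exprn_ge0 2 (normr_ge0 (\det C)).
by rewrite norm_det -signr_odd r_odd expr1 oppr_ge0 ler10.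
Qed.

Lemma eigenspace_dimension :
  exists r, (#|gT| = p.+1 * #|'N(<[c]>)%g| + q * p ^ 2 * r)%N /\
    forall y, (x ^ y = x^-1)%g -> (y ^+ 2 = x ^+ (p ^ k))%g -> p = 2%N -> ~~ odd r.
Proof. by exists (\rank Phi); split; [apply: rank_Phi | apply: rank_Phi_even]. Qed.

End Eigenspace.

End ElementaryAbelianUnits.

(** Case P = <[x]>, with |N(Z)| = m q. Cancelling q and then p leaves m t q' p = m + p r. *)
Lemma dvdn_rank_equation p q' m t r : (0 < p)%N -> (0 < q')%N ->
  let q := (p * p * q')%N in
  (m * q * (1 + t * q) = p.+1 * (m * q) + q * p ^ 2 * r)%N -> (p %| m)%N.
Proof.
move=> p_gt0 q'_gt0 q; have q_gt0 : (0 < q)%N by rewrite !muln_gt0 p_gt0.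
rewrite -mulnn => eq_q.
have /eqP : (q * (m * (1 + t * q)) = q * (p.+1 * m + p * p * r))%N by lia.
rewrite eqn_pmul2l // /q => /eqP eq1.
have /eqP : (p * (m * t * q' * p) = p * (m + p * r))%N by lia.
rewrite eqn_pmul2l // => /eqP eq2.
by apply/dvdnP; exists (m * t * q' - r)%N; rewrite mulnBl; lia.
Qed.

(** Quaternion case: |P| = 2 q, |N(Z)| = 2 m q and p + 1 = 3. *)
Lemma rank_equation_even q m t r : (0 < q)%N ->
  (m * (2 * q) * (1 + t * (2 * q)) = 3 * (m * (2 * q)) + q * 2 ^ 2 * r)%N ->
  (m * t * q = m + r)%N.
Proof.
move=> q_gt0 eq_q; apply/eqP; rewrite -(eqn_pmul2l q_gt0); apply/eqP; lia.
Qed.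

Lemma p_rank_grpRing_units (gT aT : finGroupType) (p : nat) (A : {group aT})
    (alpha : aT -> grpRing int gT) :
  prime p -> (p.-abelem A)%g -> #|A| = (p ^ 2)%N ->
  {in A &, forall a b, alpha (a * b)%g = alpha a * alpha b} -> alpha 1%g = 1 ->
  {in A, forall a, a != 1%g -> alpha a != 1} ->
  {in A, forall a, augmentation (alpha a) = 1} ->
  (1 < 'r_p([set: gT])%g)%N.
Proof.
move=> p_pr abelA cardA alphaM alpha1 alpha_neq1 alpha_aug; rewrite ltnNge.
apply/negP => rank1; have p_gt1 := prime_gt1 p_pr; have p_gt0 := ltnW p_gt1.
have dvd_p2 := card_dvd_p2 p_pr abelA cardA alphaM alpha1 alpha_neq1 alpha_aug.
have [P sylP] := Sylow_exists p [set: gT].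
have oP := card_Hall sylP; have pP := pHall_pgroup sylP.
have p2P : (p ^ 2 %| #|P|)%N.
  rewrite oP cardsT -(part_pnat_id (_ : p.-nat (p ^ 2))%N) ?pnatX ?pnat_id //.
  by rewrite partn_dvd //; apply/card_gt0P; exists 1%g.
have pdvdP : (p %| #|P|)%N by apply: dvdn_trans p2P; rewrite dvdn_exp.
have ntP : (P :!=: 1)%g.
  by apply/eqP=> P1; move: pdvdP; rewrite P1 cards1 dvdn1 => /eqP p1;
    rewrite p1 in p_gt1.
have [c Pc oc] := Cauchy p_pr pdvdP.
have [t] := rank1_card_normaliser p_pr rank1 sylP Pc oc; rewrite cardsT => card_t.
have sPN : (P \subset 'N(<[c]>))%g.
  apply/subsetP=> y Py; apply/normP; rewrite -cycleJ.
  by apply: (rank1_cyclic_unique p_pr rank1 pP); rewrite ?groupJ ?orderJ.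
have [m' cardN] := dvdnP (cardSg sPN).
(* m' is the index of P in N(<[c]>), a divisor of the index of P in G. *)
have co_m' : ~~ (p %| m')%N.
  have /and3P[_ _] := sylP; rewrite p'natE //; apply: contra => /dvdn_trans -> //.
  have := Lagrange (pHall_sub sylP); rewrite cardsT card_t cardN mulnAC mulnC => /eqP.
  by rewrite eqn_pmul2r ?cardG_gt0 // => /eqP->; rewrite dvdn_mulr.
have [x [k [Px ox structP]]] := rank1_pgroup_structure p_pr rank1 pP ntP.
have [|mu mu_prim] := @C_prim_root_exists (p ^ k.+1); first by rewrite expn_gt0 p_gt0.
have [r []] := eigenspace_dimension p_pr abelA cardA alphaM alpha1 alpha_neq1
  alpha_aug rank1 ox mu_prim oc.
rewrite card_t cardN => rankE r_even.
have q_gt0 : (0 < p ^ k.+1)%N by rewrite expn_gt0 p_gt0.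
case: structP => [oPq | [p2 k_gt0 oPq [y [xy y2]]]].
  have [q' qE] : exists q', (p ^ k.+1 = p * p * q')%N.
    by move: p2P; rewrite oPq => /dvdnP[q' ->]; exists q'; rewrite mulnC mulnn.
  case/negP: co_m'; apply: (@dvdn_rank_equation p q' m' t r p_gt0).
    by move: q_gt0; rewrite qE; case: (q') => //; rewrite muln0.
  by move: rankE; rewrite oPq qE.
(* The equation m' t q = m' + r is contradictory for q and r even and m' odd. *)
have := r_even y xy y2 p2; rewrite p2 in co_m'.
set q := (p ^ k.+1)%N in q_gt0 rankE.
have qE : q = (2 * 2 ^ k)%N by rewrite /q p2 expnS.
move: rankE; rewrite oPq expnS -/q p2 => /(rank_equation_even q_gt0); rewrite qE.
move/(congr1 odd).
by rewrite oddD !oddM /= !andbF; move: co_m'; rewrite dvdn2 negbK => ->; case: odd.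
Qed.

(** * Conjugacy of units of prime order with group elements in Q Sym(G) *)

Section RegularSums.
Variables (gT : finGroupType) (p : nat).
Hypothesis p_pr : prime p.
Let f := regular_morph gT.

(** The class function [F] on G is induced from Sym(G), where all images of elements of order p are
    conjugate; so it is constant on them and [pairing_eq_on_order_p] applies. *)
Lemma sum_conj_regular (v : grpRing int gT) x h :
  v ^+ p = 1 -> v != 1 -> augmentation v = 1 -> #[x]%g = p ->
  \sum_y grpRing_intQ f v (h ^ y)%g = \sum_y grpRing_of rat (f x) (h ^ y)%g.
Proof.
move=> vp1 v1 augv ox; pose F g := conj_count h (f g).
have FC : is_class_fun F.
  by move=> g1 g2; rewrite /F !morphM ?inE // conj_countC.
have Fx g : #[g]%g = p -> F g = F x.
  move=> og; have [s fxs] := regular_conjugate (prime_gt0 p_pr) ox og.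
  by rewrite /F -fxs class_funJ //; apply: conj_countC.
transitivity ((pairing F v)%:~R : rat).
  under eq_bigr => y _ do rewrite ffunE.
  rewrite (exchange_big_dep predT) //= rmorph_sum; apply: eq_bigr => g _.
  rewrite sumr_const /= intrM -mulr_natr; congr (_ * _).
  rewrite -[LHS]/(_%:Z%:~R); congr (_%:~R); congr (_%:Z).
  by apply: eq_card => y; rewrite !inE eq_sym.
rewrite (pairing_eq_on_order_p p_pr vp1 v1 augv FC Fx) /F /conj_count.
under [RHS]eq_bigr => y _ do rewrite ffunE.
rewrite -natr_sum -[LHS]/(_%:R) -sum1_card big_mkcond /=; congr (_%:R).
by apply: eq_bigr => y _; rewrite inE; case: eqP.
Qed.

Lemma grp_hom_intQ (aT : finGroupType) (A : {group aT}) (alpha : aT -> grpRing int gT) :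
  alpha 1%g = 1 -> {in A &, forall a b, alpha (a * b)%g = alpha a * alpha b} ->
  grp_hom A (fun a => grpRing_intQ f (alpha a)).
Proof.
move=> alpha1 alphaM; split=> [|a b Aa Ab]; last by rewrite alphaM // grpRing_intQM.
by rewrite alpha1 -[1]/(grpRing_of int 1%g) grpRing_intQ_of morph1.
Qed.

Lemma grp_hom_of (aT : finGroupType) (A : {group aT}) (psi : aT -> gT) :
  psi 1%g = 1%g -> {in A &, {morph psi : a b / (a * b)%g}} ->
  grp_hom A (fun a => grpRing_of rat (f (psi a))).
Proof.
move=> psi1 psiM; split=> [|a b Aa Ab]; first by rewrite psi1 morph1.
by rewrite psiM // morphM ?inE // grpRing_ofM.
Qed.

Lemma conjugate_to_regular (aT : finGroupType) (A : {group aT})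
    (alpha : aT -> grpRing int gT) (psi : aT -> gT) :
  alpha 1%g = 1 -> {in A &, forall a b, alpha (a * b)%g = alpha a * alpha b} ->
  psi 1%g = 1%g -> {in A &, {morph psi : a b / (a * b)%g}} ->
  {in A, forall a, a != 1%g ->
     [/\ alpha a ^+ p = 1, alpha a != 1, augmentation (alpha a) = 1
       & #[psi a]%g = p]} ->
  exists2 w : grpRing rat {perm gT}, w \is a GRing.unit & {in A, forall a,
    grpRing_of rat (f (psi a)) = w^-1 * grpRing_intQ f (alpha a) * w}.
Proof.
move=> alpha1 alphaM psi1 psiM ap.
apply: (rational_conjugacy (grp_hom_intQ alpha1 alphaM) (grp_hom_of psi1 psiM)).
move=> a h Aa; have [-> | a1] := eqVneq a 1%g.
  rewrite (grp_hom_intQ alpha1 alphaM).1 (grp_hom_of psi1 psiM).1 //.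
by have [] := ap a Aa a1; apply: sum_conj_regular.
Qed.

End RegularSums.

Lemma abelem_setX_Zp p : prime p ->
  (p.-abelem (setX_group (Zp_group p) (Zp_group p)))%g
  /\ #|setX_group (Zp_group p) (Zp_group p)| = (p ^ 2)%N.
Proof.
move=> p_pr; have cardZp : #|Zp p| = p by rewrite card_Zp ?prime_gt0.
split; last by rewrite /= cardsX cardZp mulnn.
have [_ ZpX] := abelemP p_pr (prime_abelem p_pr cardZp).
have expE (x : 'Z_p * 'Z_p) m : (x ^+ m = (x.1 ^+ m, x.2 ^+ m))%g.
  by elim: m => [|m IHm] //; rewrite !expgS IHm.
apply/abelemP => //; split.
  by apply/centsP=> -[a b] _ [c d] _; congr (_, _); apply: Zp_mulgC.
by move=> [a b]; rewrite inE /= => /andP[Za Zb]; rewrite expE /= !ZpX.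
Qed.

(** Otherwise the constant 1 satisfies vacuously the hypothesis of [pairing_eq_on_order_p] with c =
    0, and u has augmentation 0. *)
Lemma exists_order_p (gT : finGroupType) p (u : grpRing int gT) : prime p ->
  u ^+ p = 1 -> u != 1 -> augmentation u = 1 -> exists g : gT, #[g]%g = p.
Proof.
move=> p_pr up1 u1 augu; have [/existsP[g /eqP og]|] :=
  boolP [exists g : gT, #[g]%g == p].
  by exists g.
move/existsPn=> no_g; have : pairing (fun=> 1) u = 0.
  apply: (pairing_eq_on_order_p p_pr) => // x ox.
  by have := no_g x; rewrite ox eqxx.
rewrite /pairing; under eq_bigr => x _ do rewrite mulr1.
by rewrite -[\sum_x _]/(augmentation u) augu => /eqP; rewrite oner_eq0.
Qed.

Theorem corollary5p2 (gT : finGroupType) (p : nat) (p_pr : prime p) :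
  (forall u : grpRing int gT,
     u \in normalized_unit int gT -> has_order u p ->
     exists (hT : finGroupType) (f : {morphism [set: gT] >-> hT}),
       ('injm f)%g /\
       exists g : gT,
         conjugate_elts (grpRing_intQ f u) (grpRing_of rat (f g)))
  /\
  (forall U : {pred grpRing int gT},
     {subset U <= normalized_unit int gT} -> GRing.divr_closed U ->
     isomorphic_to U (setX_group (Zp_group p) (Zp_group p)) ->
     exists (hT : finGroupType) (f : {morphism [set: gT] >-> hT}),
       ('injm f)%g /\
       exists K : {group gT},
         conjugate_sets
           (fun a => exists2 u, u \in U & a = grpRing_intQ f u)
           (fun b => exists2 k, k \in K & b = grpRing_of rat (f k))).
Proof.
have p_gt1 := prime_gt1 p_pr; split.
  move=> u /andP[_ /eqP augu] [_ up1 u_lt]; have u1 : u != 1.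
    by apply/eqP; rewrite -[u]expr1; apply: u_lt.
  have [g og] := exists_order_p p_pr up1 u1 augu.
  exists {perm gT}, (regular_morph gT); split; first exact: injm_regular.
  (* Powers of u are indexed by ['Z_p], whose modulus is p because p > 1. *)
  exists g; have valM (a b : 'Z_p) : nat_of_ord (a * b)%g = ((a + b) %% p)%N.
    by rewrite /= [X in (_ %% X)%N = _]Zp_cast.
  have lt_a (a : 'Z_p) : (a < p)%N by have := ltn_ord a;
    rewrite [X in (_ < X)%N]Zp_cast.
  have [||||a _ a1|w wu defw] := @conjugate_to_regular gT p p_pr 'Z_p [set: 'Z_p]%G
      (fun a : 'Z_p => u ^+ a) (fun a : 'Z_p => (g ^+ a)%g).
  - by [].
  - by move=> a b _ _; rewrite valM expr_mod // exprD.
  - by [].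
  - by move=> a b _ _; rewrite valM -[in X in (_ %% X)%N]og expg_mod_order expgD.
  - have a_gt0 : (0 < a)%N by rewrite lt0n.
    have co_pa : coprime p a by rewrite prime_coprime // gtnNdvd.
    split; rewrite ?augmentationX ?augu ?expr1n //; first by rewrite exprAC up1 expr1n.
      by apply/eqP/u_lt; rewrite a_gt0 lt_a.
    by rewrite orderXgcd og (eqP co_pa) divn1.
  by exists w => //; have := defw (1 : 'Z_p) (in_setT _); rewrite expr1 expg1.
move=> U sUV _ [phi [phiM phiI phiU]].
set A := setX_group _ _ in phiM phiI phiU.
have [abelA cardA] := abelem_setX_Zp p_pr; rewrite -/A in abelA cardA.
have Uphi a : a \in A -> phi a \in U by move=> Aa; apply/phiU; exists a.
have phi1 : phi 1%g = 1.
  have /andP[unit1 _] := sUV _ (Uphi _ (group1 A)).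
  by apply: (mulrI unit1); rewrite -phiM ?group1 // mulg1 mulr1.
have phi_neq1 : {in A, forall a, a != 1%g -> phi a != 1}.
  move=> a Aa; apply: contraNneq => phia; apply/eqP; apply: phiI => //.
  by rewrite phia phi1.
have phi_aug : {in A, forall a, augmentation (phi a) = 1}.
  by move=> a Aa; have /andP[_ /eqP] := sUV _ (Uphi a Aa).
(* [K] is elementary abelian of order p^2 in G, hence isomorphic to A; U is conjugate to the whole
   of [K]. *)
have /p_rank_geP[K] := p_rank_grpRing_units p_pr abelA cardA phiM phi1 phi_neq1 phi_aug.
case/pnElemPcard=> _ abelK cardK.
have /isogP[psi injpsi psiA] : A \isog K.
  by rewrite (isog_abelem_card _ abelA) abelK cardA cardK eqxx.
have [_ Ap] := abelemP p_pr abelA.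
exists {perm gT}, (regular_morph gT); split; first exact: injm_regular.
exists K.
have [|||a Aa a1|w wu defw] := @conjugate_to_regular gT p p_pr _ A phi psi phi1.
- exact: phiM.
- exact: morph1.
- exact: morphM.
- split; rewrite ?phi_neq1 ?phi_aug //.
    have phiX j : phi (a ^+ j)%g = phi a ^+ j.
      elim: j => [|j IHj]; first by rewrite expg0 expr0.
      by rewrite expgS exprS phiM ?groupX // IHj.
    by rewrite -phiX Ap.
  by rewrite order_injm // (abelem_order_p abelA).
exists w => // b; split=> [[k Kk ->] | [_ [v Uv ->] ->]].
  have: k \in (psi @* A)%g by rewrite psiA.
  case/morphimP=> a _ Aa ->; exists (grpRing_intQ (regular_morph gT) (phi a)).
    by exists (phi a) => //; apply: Uphi.
  exact: defw.
have [a Aa ->] := (phiU v).1 Uv; exists (psi a); last by rewrite defw.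
by rewrite -psiA mem_morphim.
Qed.
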